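(* The quotient category $\overline{\mathcal{C}}_{(S,M)}=\mathcal{C}_{(S',M')}[\Sigma^{-1}]$ is a triangulated $k$-category and the quotient functor $\pi:\mathcal{C}_{(S',M')}\to\overline{\mathcal{C}}_{(S,M)}$ is an exact functor of triangulated categories.
   Context: Setting. Let $k$ be an algebraically closed field and $S$ a closed disk whose boundary circle $\partial S$ is oriented counter-clockwise. $M\subset\partial S$ is an infinite set of marked points with set of accumulation points $\mathrm{acc}(M)\subset\partial S$. Assume $M$ is discrete (every $m\in M$ has a neighbourhood meeting $M$ only in $m$), and $\mathrm{acc}(M)=\{z_1,\dots,z_n\}$ is finite with every $z_i$ two-sided (a limit of sequences of pairwise distinct points of $M$ from both sides). Let $S'$ be the disk obtained by replacing each $z_i$ by an ''added'' interval $[z_i^-,z_i^+]$ containing new points $z_{ij}\in(z_i^-,z_i^+)$, $j\in\mathbb{Z}$, increasing counter-clockwise in $j$, with $\lim_{j\to\pm\infty}z_{ij}=z_i^{\pm}$; put $M'=M\cup\{z_{ij}\}$. $M'$ is again discrete with finitely many accumulation points, all two-sided. For $m\in M'$ let $\sigma(m)$ (resp. $\sigma^{-}(m)$) be the next point of $M'$ in clockwise (resp. counter-clockwise) direction. An arc of $(S',M')$ is a pair $\{a,b\}$ of distinct non-neighbouring points of $M'$ (pairs of neighbours are boundary segments and are identified with the zero object). Two arcs cross if their four endpoints are distinct and alternate on the circle. The category $\mathcal{C}=\mathcal{C}_{(S',M')}$ is the Igusa–Todorov discrete cluster category of type $\mathbb{A}$: a Hom-finite Krull–Schmidt 2-Calabi–Yau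 triangulated $k$-category with suspension $[1]$ whose isoclasses of indecomposables $X$ are in bijection with arcs $\ell_X$; if $\ell_X=\{a,b\}$ then $\ell_{X[1]}=\{\sigma(a),\sigma(b)\}$; $\mathrm{Hom}(X,Y[1])$ is $k$ if $\ell_X,\ell_Y$ cross and $0$ otherwise; and for $a_1,a_2,a_3,a_4$ in counter-clockwise order, with $\ell_X=\{a_1,a_3\}$, $\ell_Y=\{a_2,a_4\}$, $\ell_A=\{a_1,a_2\}$, $\ell_B=\{a_2,a_3\}$, $\ell_C=\{a_3,a_4\}$, $\ell_D=\{a_4,a_1\}$, there are non-split exact triangles $X\to B\oplus D\to Y\to X[1]$ and $Y\to A\oplus C\to X\to Y[1]$. $\mathcal{D}\subset\mathcal{C}$ is the full additive subcategory generated by indecomposables whose arcs have both endpoints in one interval $(z_i^-,z_i^+)$. $\Sigma$ is the class of morphisms $f:X\to Y$ of $\mathcal{C}$ for which the exact triangle $X\xrightarrow{f}Y\to Z\to X[1]$ has $Z\in\mathcal{D}$. $\mathcal{C}[\Sigma^{-1}]$ has the objects of $\mathcal{C}$; its morphisms $X\to Y$ are equivalence classes of left fractions $(f,g)$: $X\xrightarrow{f}Y'\xleftarrow{g}Y$ with $g\in\Sigma$, where $(f_1,g_1)$ and $(f_2,g_2)$ (through $Y_1$, $Y_2$) are equivalent if there are an object $Y_3$ and morphisms $h_i:Y_i\to Y_3$ with $h_1f_1=h_2f_2$ and $h_1g_1=h_2g_2\in\Sigma$. For $f:X\to Y$ in $\mathcal{C}$, $\pi(f)=(f,1_Y)$.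 *)

(* Defs.v *)
From HB Require Import structures.
From mathcomp Require Import all_boot all_order all_algebra.
From mathcomp Require Import all_classical all_reals all_analysis.

Set Implicit Arguments.
Unset Strict Implicit.
Unset Printing Implicit Defensive.

Import Order.TTheory GRing.Theory Num.Theory.
Import numFieldNormedType.Exports.

Local Open Scope classical_set_scope.
Local Open Scope ring_scope.

Declare Scope kcat_scope.
Local Open Scope kcat_scope.

(** * Linear categories *)

Record kcat_mixin (k : fieldType) (ob : Type) (mor : ob -> ob -> lmodType k) :=
  KCatMixin {
  idm_ : forall X : ob, mor X X;
  comp_ : forall X Y Z : ob, mor Y Z -> mor X Y -> mor X Z;
  comp1m_ : forall (X Y : ob) (f : mor X Y), comp_ (idm_ Y) f = f;
  compm1_ : forall (X Y : ob) (f : mor X Y), comp_ f (idm_ X) = f;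
  compA_ : forall (X Y Z W : ob) (h : mor Z W) (g : mor Y Z) (f : mor X Y),
    comp_ h (comp_ g f) = comp_ (comp_ h g) f;
  comp_linl_ : forall (X Y Z : ob) (f : mor X Y) (a : k) (g g' : mor Y Z),
    comp_ (a *: g + g') f = a *: comp_ g f + comp_ g' f;
  comp_linr_ : forall (X Y Z : ob) (g : mor Y Z) (a : k) (f f' : mor X Y),
    comp_ g (a *: f + f') = a *: comp_ g f + comp_ g f' }.

Record kcat (k : fieldType) := KCat {
  ob :> Type;
  mor : ob -> ob -> lmodType k;
  kcat_mixin_of : kcat_mixin mor }.

Definition idm (k : fieldType) (A : kcat k) (X : A) : mor X X :=
  idm_ (kcat_mixin_of A) X.

Definition mcomp (k : fieldType) (A : kcat k) (X Y Z : A)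
  (g : mor Y Z) (f : mor X Y) : mor X Z := comp_ (kcat_mixin_of A) g f.

Arguments idm {k A} X.
Notation "g ∘ f" := (mcomp g f) (at level 40, left associativity) : kcat_scope.

Section CategoryNotions.
Variables (k : fieldType) (A : kcat k).

Definition is_iso (X Y : A) (f : mor X Y) : Prop :=
  exists g : mor Y X, g ∘ f = idm X /\ f ∘ g = idm Y.

Definition isomorphic (X Y : A) : Prop := exists f : mor X Y, is_iso f.

Definition is_zero (X : A) : Prop := idm X = 0.

(* [X] is a biproduct of the finite family [Y]; for [n = 0], a zero object. *)
Definition direct_sum (n : nat) (Y : 'I_n -> A) (X : A) : Prop :=
  exists (inj : forall i, mor (Y i) X) (proj : forall i, mor X (Y i)),
    [/\ forall i, proj i ∘ inj i = idm (Y i),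
        forall i j, i != j -> proj j ∘ inj i = 0
      & \sum_(i < n) (inj i ∘ proj i) = idm X].

Definition pair_fam (Y1 Y2 : A) : 'I_2 -> A :=
  fun i => if i == ord0 then Y1 else Y2.

Definition direct_sum2 (Y1 Y2 X : A) : Prop := direct_sum (pair_fam Y1 Y2) X.

Definition indecomposable (X : A) : Prop :=
  ~ is_zero X /\
  forall Y1 Y2 : A, direct_sum2 Y1 Y2 X -> is_zero Y1 \/ is_zero Y2.

(* Local ring: nonzero, and the sum of two non-units is a non-unit. *)
Definition local_end (X : A) : Prop :=
  idm X <> 0 /\
  forall f g : mor X X, ~ is_iso f -> ~ is_iso g -> ~ is_iso (f + g).

Definition krull_schmidt : Prop :=
  forall X : A, exists (n : nat) (Y : 'I_n -> A),
    (forall i, local_end (Y i)) /\ direct_sum Y X.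

End CategoryNotions.

Definition has_dim (k : fieldType) (V : lmodType k) (n : nat) : Prop :=
  exists phi : {linear 'rV[k]_n -> V}, bijective phi.

Definition hom_finite (k : fieldType) (A : kcat k) : Prop :=
  forall X Y : A, exists n, has_dim (mor X Y) n.

Record functor_mixin (k : fieldType) (A B : kcat k) (F : A -> B) :=
  FunctorMixin {
  fmap_ : forall X Y : A, mor X Y -> mor (F X) (F Y);
  fmap1_ : forall X : A, fmap_ (idm X) = idm (F X);
  fmap_comp_ : forall (X Y Z : A) (g : mor Y Z) (f : mor X Y),
    fmap_ (g ∘ f) = fmap_ g ∘ fmap_ f }.

Record functor (k : fieldType) (A B : kcat k) := Functor {
  fob :> A -> B;
  functor_mixin_of : functor_mixin fob }.

Definition fmap (k : fieldType) (A B : kcat k) (F : functor A B) (X Y : A)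
  (f : mor X Y) : mor (F X) (F Y) := fmap_ (functor_mixin_of F) f.

Definition klinear (k : fieldType) (A B : kcat k) (F : functor A B) : Prop :=
  forall (X Y : A) (a : k) (f g : mor X Y),
    fmap F (a *: f + g) = a *: fmap F f + fmap F g.

Definition equivalence (k : fieldType) (A B : kcat k) (F : functor A B) : Prop :=
  (forall X Y : A, bijective (@fmap k A B F X Y)) /\
  (forall Y : B, exists X : A, isomorphic (F X) Y).

(** * Triangulated categories *)

(* The suspension is a k-linear autoequivalence, not necessarily an
   automorphism. *)
Record tri_mixin (k : fieldType) (A : kcat k) := TriMixin {
  susp_ : functor A A;
  susp_linear_ : klinear susp_;
  susp_equiv_ : equivalence susp_;
  has_sums_ : forall (n : nat) (Y : 'I_n -> A), exists X : A, direct_sum Y X;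
  dist_ : forall X Y Z : A, mor X Y -> mor Y Z -> mor Z (susp_ X) -> Prop;
  (* TR1 *)
  dist_iso_ : forall (X Y Z X' Y' Z' : A)
      (f : mor X Y) (g : mor Y Z) (h : mor Z (susp_ X))
      (f' : mor X' Y') (g' : mor Y' Z') (h' : mor Z' (susp_ X'))
      (a : mor X X') (b : mor Y Y') (c : mor Z Z'),
    is_iso a -> is_iso b -> is_iso c ->
    b ∘ f = f' ∘ a -> c ∘ g = g' ∘ b -> fmap susp_ a ∘ h = h' ∘ c ->
    dist_ f g h -> dist_ f' g' h';
  dist_idm_ : forall X Z : A, is_zero Z ->
    dist_ (idm X) (0 : mor X Z) (0 : mor Z (susp_ X));
  dist_cone_ : forall (X Y : A) (f : mor X Y),
    exists (Z : A) (g : mor Y Z) (h : mor Z (susp_ X)), dist_ f g h;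
  (* TR2 *)
  dist_rot_ : forall (X Y Z : A)
      (f : mor X Y) (g : mor Y Z) (h : mor Z (susp_ X)),
    dist_ f g h <-> dist_ g h (- fmap susp_ f);
  (* TR3 *)
  dist_fill_ : forall (X Y Z X' Y' Z' : A)
      (f : mor X Y) (g : mor Y Z) (h : mor Z (susp_ X))
      (f' : mor X' Y') (g' : mor Y' Z') (h' : mor Z' (susp_ X'))
      (a : mor X X') (b : mor Y Y'),
    dist_ f g h -> dist_ f' g' h' -> b ∘ f = f' ∘ a ->
    exists c : mor Z Z', c ∘ g = g' ∘ b /\ fmap susp_ a ∘ h = h' ∘ c;
  (* TR4, the octahedral axiom *)
  dist_oct_ : forall (X Y Z X' Y' Z' : A) (f : mor X Y) (g : mor Y Z)
      (u : mor Y Z') (u' : mor Z' (susp_ X))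
      (v : mor Z X') (v' : mor X' (susp_ Y))
      (w : mor Z Y') (w' : mor Y' (susp_ X)),
    dist_ f u u' -> dist_ g v v' -> dist_ (g ∘ f) w w' ->
    exists (a : mor Z' Y') (b : mor Y' X'),
      [/\ dist_ a b (fmap susp_ u ∘ v'),
          w ∘ g = a ∘ u /\ w' ∘ a = u'
        & b ∘ w = v /\ v' ∘ b = fmap susp_ f ∘ w'] }.

Record tricat (k : fieldType) := TriCat {
  tricat_kcat :> kcat k;
  tri_mixin_of : tri_mixin tricat_kcat }.

Definition susp (k : fieldType) (A : tricat k) : functor A A :=
  susp_ (tri_mixin_of A).

Notation "X [1]" := (susp _ X) (at level 1, left associativity, format "X [1]")
  : kcat_scope.

Definition dist (k : fieldType) (A : tricat k) (X Y Z : A)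
  (f : mor X Y) (g : mor Y Z) (h : mor Z X[1]) : Prop :=
  @dist_ _ _ (tri_mixin_of A) X Y Z f g h.

Definition exact_functor (k : fieldType) (A B : tricat k) (F : functor A B) :
    Prop :=
  klinear F /\
  exists eta : forall X : A, mor (F X[1]) (F X)[1],
    [/\ forall X, is_iso (eta X),
        forall (X Y : A) (f : mor X Y),
          eta Y ∘ fmap F (fmap (susp A) f) = fmap (susp B) (fmap F f) ∘ eta X
      & forall (X Y Z : A) (f : mor X Y) (g : mor Y Z) (h : mor Z X[1]),
          dist f g h -> dist (fmap F f) (fmap F g) (eta X ∘ fmap F h)].

(* The triangle is not split, i.e., its first morphism is not a section. *)
Definition nonsplit_dist (k : fieldType) (A : tricat k) (X Y Z : A)
    (f : mor X Y) (g : mor Y Z) (h : mor Z X[1]) : Prop :=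
  dist f g h /\ ~ (exists r : mor Y X, r ∘ f = idm X).

(* Bifunctorial isomorphism Hom(X,Y) -> Hom(Y,X[2])^*. *)
Definition calabi_yau2 (k : fieldType) (A : tricat k) : Prop :=
  exists cy : forall X Y : A, mor X Y -> {linear mor Y X[1][1] -> k^o},
    [/\ forall X Y, bijective (cy X Y),
        forall (X Y : A) (a : k) (f f' : mor X Y) (g : mor Y X[1][1]),
          cy X Y (a *: f + f') g = a * cy X Y f g + cy X Y f' g
      & forall (X X' Y Y' : A) (u : mor X' X) (f : mor X Y) (v : mor Y Y')
               (g : mor Y' X'[1][1]),
          cy X' Y' (v ∘ f ∘ u) g =
          cy X Y f (fmap (susp A) (fmap (susp A) u) ∘ g ∘ v)].

(** * Localization by left fractions *)

Section LeftFractions.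
Variables (k : fieldType) (A : kcat k) (S : forall X Y : A, mor X Y -> Prop).

(* A diagram X -> Y' <- Y; it is a left fraction when [S (den p)]. *)
Record cospan (X Y : A) := Cospan {
  roof : A;
  num : mor X roof;
  den : mor Y roof }.

Definition frac_equiv (X Y : A) (p q : cospan X Y) : Prop :=
  exists (W : A) (h1 : mor (roof p) W) (h2 : mor (roof q) W),
    [/\ h1 ∘ num p = h2 ∘ num q, h1 ∘ den p = h2 ∘ den q
      & S (h1 ∘ den p)].

Definition frac_class (X Y : A) (p : cospan X Y) : set (cospan X Y) :=
  [set q | S (den q) /\ frac_equiv p q].

Definition loc_hom (X Y : A) : Type :=
  {c : set (cospan X Y) | exists2 p, S (den p) & c = frac_class p}.

(* [comp_] and [idm_] are those of the category of left fractions: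
   the composite of X -f-> Y' <-g- Y and Y -f'-> Z' <-g'- Z is represented by
   (h o f, h' o g') for any h : Y' -> W and h' : Z' -> W in S with
   h o g = h' o f'. *)
Definition fraction_category
    (V : forall X Y : A, GRing.Lmodule.axioms_ k (loc_hom X Y))
    (m : kcat_mixin (fun X Y : A => GRing.Lmodule.Pack (V X Y))) : Prop :=
  [/\ forall (X Y : A),
        [/\ forall p : cospan X Y, S (den p) -> frac_equiv p p,
            forall p q : cospan X Y, S (den p) -> S (den q) ->
              frac_equiv p q -> frac_equiv q p
          & forall p q r : cospan X Y, S (den p) -> S (den q) -> S (den r) ->
              frac_equiv p q -> frac_equiv q r -> frac_equiv p r],
      forall X : A, sval (idm_ m X) = frac_class (Cospan (idm X) (idm X))
    & forall (X Y Z : A) (a : loc_hom X Y) (b : loc_hom Y Z)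
          (Y' Z' W : A) (f : mor X Y') (g : mor Y Y')
          (f' : mor Y Z') (g' : mor Z Z') (h : mor Y' W) (h' : mor Z' W),
        S g -> S g' -> S h' ->
        sval a = frac_class (Cospan f g) ->
        sval b = frac_class (Cospan f' g') ->
        h ∘ g = h' ∘ f' ->
        sval (comp_ m b a) = frac_class (Cospan (h ∘ f) (h' ∘ g'))].

End LeftFractions.

(** * Marked disks *)

Section MarkedDisk.
Variable R : realType.
Implicit Types (M : set (R * R)) (z : R * R).

(* The boundary of the unit disk. *)
Definition circle : set (R * R) := [set x | x.1 ^+ 2 + x.2 ^+ 2 = 1].

(* For points of the circle: a, b, c are distinct and in counter-clockwise
   order, i.e., the triangle a b c is positively oriented. *)
Definition ccw (a b c : R * R) : Prop :=
  0 < (b.1 - a.1) * (c.2 - a.2) - (b.2 - a.2) * (c.1 - a.1).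

Definition acc M : set (R * R) := limit_point M.

(* [x] lies on the open half circle that follows [z] counter-clockwise. *)
Definition ccw_side z (x : R * R) : Prop := 0 < z.1 * x.2 - z.2 * x.1.

Definition two_sided M z : Prop :=
  (exists u : nat -> R * R,
     [/\ injective u, forall n, M (u n), forall n, ccw_side z (u n)
       & u @ \oo --> z]) /\
  (exists u : nat -> R * R,
     [/\ injective u, forall n, M (u n), forall n, ccw_side (u n) z
       & u @ \oo --> z]).

Record marked_disk M : Prop := MarkedDisk {
  marked_on_circle : M `<=` circle;
  marked_infinite : infinite_set M;
  marked_discrete : forall m, M m -> isolated M m;
  acc_finite : finite_set (acc M);
  acc_two_sided : forall z, acc M z -> two_sided M z }.

(* Boundary points of S', the disk S with each z in acc(M) replaced by an
   interval [z^-, z^+]: [(x, 0)] is the point x of the circle when x is not in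
   acc(M); for z in acc(M), the points of [z^-, z^+] are [(z, s)] with s in
   [0, 1], where z^- = (z, 0) and z^+ = (z, 1). *)
Definition bpoint : Type := ((R * R) * R)%type.
Implicit Types (p q : bpoint).

(* The points of the open interval (z^-, z^+). *)
Definition added_interval M z : set bpoint :=
  [set p | acc M z /\ p.1 = z /\ 0 < p.2 < 1].

(* Counter-clockwise order on the boundary of S', the intervals being
   oriented from z^- to z^+. *)
Definition ccw' p q r : Prop :=
  ccw p.1 q.1 r.1 \/
  [/\ p.1 = q.1, q.1 <> r.1 & p.2 < q.2] \/
  [/\ q.1 = r.1, r.1 <> p.1 & q.2 < r.2] \/
  [/\ r.1 = p.1, p.1 <> q.1 & r.2 < p.2] \/
  [/\ p.1 = q.1, q.1 = r.1 &
      [\/ p.2 < q.2 /\ q.2 < r.2, q.2 < r.2 /\ r.2 < p.2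
        | r.2 < p.2 /\ p.2 < q.2]].

(* [t z j] is the position of z_j in (z^-, z^+). *)
Record added_points M (t : R * R -> int -> R) : Prop := AddedPoints {
  added_in : forall z j, acc M z -> 0 < t z j < 1;
  added_increasing : forall z i j, acc M z -> (i < j)%R -> t z i < t z j;
  added_lim_plus : forall z, acc M z -> (fun n : nat => t z n%:Z) @ \oo --> (1 : R);
  added_lim_minus : forall z, acc M z ->
    (fun n : nat => t z (- n%:Z)) @ \oo --> (0 : R) }.

Definition marked' M (t : R * R -> int -> R) : set bpoint :=
  [set (m, 0) | m in M] `|`
  [set p | exists z (j : int), acc M z /\ p = (z, t z j)].

(* [q] is the next point of N after [p] in clockwise direction. *)
Definition cw_next (N : set bpoint) p q : Prop :=
  [/\ N p, N q, q <> p & forall x, N x -> ~ ccw' q x p].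

Definition neighbours (N : set bpoint) p q : Prop :=
  cw_next N p q \/ cw_next N q p.

Definition is_arc (N : set bpoint) (l : set bpoint) : Prop :=
  exists p q, [/\ N p, N q, p <> q, ~ neighbours N p q & l = [set p; q]].

Definition cross (l l' : set bpoint) : Prop :=
  exists p q r s,
    [/\ l = [set p; q], l' = [set r; s], ccw' p r q & ccw' q s p].

End MarkedDisk.

(** * The Igusa-Todorov category *)

Section ClusterCategory.
Variables (k : fieldType) (R : realType) (N : set (bpoint R)).
Variables (C : tricat k) (l : C -> set (bpoint R)).

(* [X] is the object attached to the pair {p, q}: zero for a boundary
   segment. *)
Definition attached (X : C) (p q : bpoint R) : Prop :=
  [/\ N p, N q, p <> q &
      (neighbours N p q /\ is_zero X) \/
      [/\ ~ neighbours N p q, indecomposable X & l X = [set p; q]]].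

(* [l X] is the arc of X; it is meaningful for indecomposable X only. *)
Record cluster_category : Prop := ClusterCategory {
  cluster_hom_finite : hom_finite C;
  cluster_krull_schmidt : krull_schmidt C;
  cluster_calabi_yau : calabi_yau2 C;
  arc_of_indec : forall X : C, indecomposable X -> is_arc N (l X);
  arc_inj : forall X Y : C, indecomposable X -> indecomposable Y ->
    (l X = l Y <-> isomorphic X Y);
  arc_surj : forall a, is_arc N a ->
    exists X : C, indecomposable X /\ l X = a;
  arc_susp : forall (X : C) p q p' q', indecomposable X -> l X = [set p; q] ->
    cw_next N p p' -> cw_next N q q' -> l X[1] = [set p'; q'];
  hom_cross : forall X Y : C, indecomposable X -> indecomposable Y ->
    cross (l X) (l Y) -> has_dim (mor X Y[1]) 1;
  hom_noncross : forall X Y : C, indecomposable X -> indecomposable Y ->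
    ~ cross (l X) (l Y) -> has_dim (mor X Y[1]) 0;
  cross_triangles : forall p1 p2 p3 p4 (X Y A B C' D BD AC : C),
    ccw' p1 p2 p3 -> ccw' p1 p3 p4 ->
    attached X p1 p3 -> attached Y p2 p4 ->
    attached A p1 p2 -> attached B p2 p3 ->
    attached C' p3 p4 -> attached D p4 p1 ->
    direct_sum2 B D BD -> direct_sum2 A C' AC ->
    (exists (f : mor X BD) (g : mor BD Y) (h : mor Y X[1]),
       nonsplit_dist f g h) /\
    (exists (f : mor Y AC) (g : mor AC X) (h : mor X Y[1]),
       nonsplit_dist f g h) }.

(* The subcategory D, for a family [I] of intervals of the boundary. *)
Definition subcat_D (T : Type) (I : T -> set (bpoint R)) (X : C) : Prop :=
  exists (n : nat) (Y : 'I_n -> C),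
    (forall i, indecomposable (Y i) /\ exists z : T, l (Y i) `<=` I z) /\
    direct_sum Y X.

Definition Sigma (T : Type) (I : T -> set (bpoint R)) (X Y : C) (f : mor X Y) :
    Prop :=
  exists (Z : C) (g : mor Y Z) (h : mor Z X[1]), dist f g h /\ subcat_D I Z.

End ClusterCategory.

(* Main.v *)
Require Import Defs.
From HB Require Import structures.
From mathcomp Require Import all_boot all_order all_algebra.
From mathcomp Require Import all_classical all_reals all_analysis.
From mathcomp Require Import zify ring lra.
Require Import Defs.

Set Implicit Arguments.
Unset Strict Implicit.
Unset Printing Implicit Defensive.

(**
   The statement is Verdier's localization theorem, applied to the subcategory D
   of objects supported on the added intervals; what is specific to the disk is
   that D is a triangulated subcategory.

   That D is triangulated (subcat_D_triangulated).  An arc with both ends in one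
   added interval crosses no arc with both ends in M.  Conversely an arc {p, q}
   that is not of this kind has its ends over different points of the circle, and
   M has a point on either side of it: just after or before an end in an added
   interval, since accumulation points are two-sided, or next to a point strictly
   between two ends in M.  The two points found span an arc of M that crosses
   {p, q}.  As crossing computes the spaces Hom(X, T[1]), and by the Krull-Schmidt
   property, D consists of the X with Hom(X, T[1]) = 0 for all T whose arc has
   both ends in M (subcat_D_orthogonal).  Such an orthogonal is closed under
   extensions.  It is stable under the suspension and its inverse because these
   move the ends of an arc to neighbours, which remain in the same interval.

   From D to fractions.  The octahedral axiom, completions of squares, and
   the closure properties of D show that the morphisms with cone in D admit a
   calculus of left fractions (cone_in_left_system).  Classes of fractions are
   added over a common denominator and composed with Ore squares, which gives a
   linear category (frac_mixin).

   The triangulation.  The only facts used about the quotient functor Q are that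
   it is linear, that it inverts denominators, that a morphism to the quotient
   becomes some Q f after composition with a denominator, and that Q f = 0 only
   if a denominator kills f.  The suspension descends since D is stable under it,
   and it is fully faithful on the quotient since D is stable under its inverse.
   Triangles are those isomorphic to images of triangles.  Clearing denominators,
   Hom(-, W) is exact on them (quo_weak_coker), whence a five lemma (five_lemma).
   To complete a square of the quotient one writes it as two squares of the
   original category, one of which is made of denominators; the latter completes
   to an isomorphism of the quotient by the five lemma (quo_fill).  An octahedron
   is found over composable morphisms isomorphic to the given ones and carried
   back along the completed isomorphisms (quo_dist_oct).
*)

Import Order.TTheory GRing.Theory Num.Theory.
Import numFieldNormedType.Exports.

Local Open Scope classical_set_scope.
Local Open Scope ring_scope.
Local Open Scope kcat_scope.

(** * Linear categories *)

Section LinearMaps.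
Variables (k : fieldType) (U V : lmodType k) (F : U -> V).
Hypothesis linF : forall a u v, F (a *: u + v) = a *: F u + F v.

Lemma linmapD u v : F (u + v) = F u + F v.
Proof. by have := linF 1 u v; rewrite !scale1r. Qed.

Lemma linmap0 : F 0 = 0.
Proof. by apply: (addrI (F 0)); rewrite -linmapD !addr0. Qed.

Lemma linmapZ a u : F (a *: u) = a *: F u.
Proof. by have := linF a u 0; rewrite linmap0 !addr0. Qed.

Lemma linmapN u : F (- u) = - F u.
Proof. by rewrite -scaleN1r linmapZ scaleN1r. Qed.

Lemma linmapB u v : F (u - v) = F u - F v.
Proof. by rewrite linmapD linmapN. Qed.

Lemma linmap_sum n (u : 'I_n -> U) : F (\sum_(i < n) u i) = \sum_(i < n) F (u i).
Proof. exact: (big_morph F linmapD linmap0). Qed.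

End LinearMaps.

Section LinearCategory.
Variables (k : fieldType) (A : kcat k).
Implicit Types X Y Z W : A.

Lemma comp1m X Y (f : mor X Y) : idm Y ∘ f = f.
Proof. exact: comp1m_. Qed.

Lemma compm1 X Y (f : mor X Y) : f ∘ idm X = f.
Proof. exact: compm1_. Qed.

Lemma compA X Y Z W (h : mor Z W) (g : mor Y Z) (f : mor X Y) :
  h ∘ (g ∘ f) = h ∘ g ∘ f.
Proof. exact: compA_. Qed.

Lemma compr_eq X Y Z (f : mor X Y) (g g' : mor Y Z) : g = g' -> g ∘ f = g' ∘ f.
Proof. by move->. Qed.

Lemma comp_linl X Y Z (f : mor X Y) (a : k) (g g' : mor Y Z) :
  (a *: g + g') ∘ f = a *: (g ∘ f) + g' ∘ f.
Proof. exact: comp_linl_. Qed.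

Lemma comp_linr X Y Z (g : mor Y Z) (a : k) (f f' : mor X Y) :
  g ∘ (a *: f + f') = a *: (g ∘ f) + g ∘ f'.
Proof. exact: comp_linr_. Qed.

Definition comp0m X Y Z (f : mor X Y) : (0 : mor Y Z) ∘ f = 0 :=
  linmap0 (@comp_linl X Y Z f).
Definition compm0 X Y Z (g : mor Y Z) : g ∘ (0 : mor X Y) = 0 :=
  linmap0 (@comp_linr X Y Z g).
Definition compDm X Y Z (f : mor X Y) (g g' : mor Y Z) :
  (g + g') ∘ f = g ∘ f + g' ∘ f := linmapD (@comp_linl X Y Z f) g g'.
Definition compmD X Y Z (g : mor Y Z) (f f' : mor X Y) :
  g ∘ (f + f') = g ∘ f + g ∘ f' := linmapD (@comp_linr X Y Z g) f f'.
Definition compNm X Y Z (f : mor X Y) (g : mor Y Z) :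
  (- g) ∘ f = - (g ∘ f) := linmapN (@comp_linl X Y Z f) g.
Definition compmN X Y Z (g : mor Y Z) (f : mor X Y) :
  g ∘ (- f) = - (g ∘ f) := linmapN (@comp_linr X Y Z g) f.
Definition compBm X Y Z (f : mor X Y) (g g' : mor Y Z) :
  (g - g') ∘ f = g ∘ f - g' ∘ f := linmapB (@comp_linl X Y Z f) g g'.
Definition compmB X Y Z (g : mor Y Z) (f f' : mor X Y) :
  g ∘ (f - f') = g ∘ f - g ∘ f' := linmapB (@comp_linr X Y Z g) f f'.
Definition compmZ X Y Z (g : mor Y Z) a (f : mor X Y) :
  g ∘ (a *: f) = a *: (g ∘ f) := linmapZ (@comp_linr X Y Z g) a f.
Definition comp_sumr X Y Z (g : mor Y Z) n (f : 'I_n -> mor X Y) :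
  g ∘ (\sum_(i < n) f i) = \sum_(i < n) (g ∘ f i) :=
  linmap_sum (@comp_linr X Y Z g) f.

Lemma iso_idm X : is_iso (idm X).
Proof. by exists (idm X); rewrite comp1m. Qed.

Lemma iso_comp X Y Z (g : mor Y Z) (f : mor X Y) :
  is_iso g -> is_iso f -> is_iso (g ∘ f).
Proof.
move=> [g' [g'g gg']] [f' [f'f ff']]; exists (f' ∘ g'); split.
  by rewrite -compA (compA g') g'g comp1m.
by rewrite -compA (compA f) ff' comp1m.
Qed.

Lemma iso_opp X Y (f : mor X Y) : is_iso f -> is_iso (- f).
Proof.
by move=> [g [gf fg]]; exists (- g); rewrite !compNm !compmN !opprK.
Qed.

Lemma iso_lcancel X Y Z (g : mor Y Z) (f f' : mor X Y) :
  is_iso g -> g ∘ f = g ∘ f' -> f = f'.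
Proof.
by move=> [g' [g'g _]] /(congr1 (mcomp g')); rewrite !compA g'g !comp1m.
Qed.

Lemma iso_rcancel X Y Z (f : mor X Y) (g g' : mor Y Z) :
  is_iso f -> g ∘ f = g' ∘ f -> g = g'.
Proof.
move=> [f' [_ ff']] /(congr1 (fun h => h ∘ f')).
by rewrite -!compA ff' !compm1.
Qed.

Lemma zero_mor_from X Y (f : mor X Y) : is_zero X -> f = 0.
Proof. by move=> X0; rewrite -(compm1 f) X0 compm0. Qed.

Lemma zero_iso X Y (f : mor X Y) : is_zero X -> is_zero Y -> is_iso f.
Proof.
move=> X0 Y0; exists 0; rewrite comp0m compm0.
by split; apply/esym.
Qed.

Lemma sum0_zero (Y : 'I_0 -> A) X : direct_sum Y X -> is_zero X.
Proof. by move=> [i [p [_ _ +]]]; rewrite big_ord0 => /esym. Qed.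

Lemma isomorphic_zero X Y (f : mor X Y) : is_iso f -> is_zero X -> is_zero Y.
Proof.
move=> [g [_ fg]] X0; rewrite /is_zero -fg.
by rewrite (zero_mor_from f X0) comp0m.
Qed.

End LinearCategory.

Section LinearFunctor.
Variables (k : fieldType) (A B : kcat k) (F : functor A B).
Implicit Types X Y Z : A.

Lemma fmap1 X : fmap F (idm X) = idm (F X).
Proof. exact: fmap1_. Qed.

Lemma fmapM X Y Z (g : mor Y Z) (f : mor X Y) :
  fmap F (g ∘ f) = fmap F g ∘ fmap F f.
Proof. exact: fmap_comp_. Qed.

Lemma iso_fmap X Y (f : mor X Y) : is_iso f -> is_iso (fmap F f).
Proof. by move=> [g [gf fg]]; exists (fmap F g); rewrite -!fmapM gf fg !fmap1. Qed.

Hypothesis linF : klinear F.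

Definition fmap0 X Y : fmap F (0 : mor X Y) = 0 := linmap0 (@linF X Y).
Definition fmap_sum X Y n (f : 'I_n -> mor X Y) :
  fmap F (\sum_(i < n) f i) = \sum_(i < n) fmap F (f i) :=
  linmap_sum (@linF X Y) f.

Lemma direct_sum_fmap n (Y : 'I_n -> A) X :
  direct_sum Y X -> direct_sum (fun i => F (Y i)) (F X).
Proof.
move=> [inj [proj [pi1 pi0 ip]]].
exists (fun i => fmap F (inj i)), (fun i => fmap F (proj i)); split.
- by move=> i; rewrite -fmapM pi1 fmap1.
- by move=> i j ij; rewrite -fmapM pi0// fmap0.
- by rewrite -fmap1 -ip fmap_sum; apply: eq_bigr => i _; rewrite fmapM.
Qed.

End LinearFunctor.

(** * Calculus of left fractions *)

Record left_system (k : fieldType) (A : kcat k)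
    (S : forall X Y : A, mor X Y -> Prop) : Prop := LeftSystem {
  ls_id : forall X : A, S X X (idm X);
  ls_comp : forall (X Y Z : A) (g : mor Y Z) (f : mor X Y),
    S Y Z g -> S X Y f -> S X Z (g ∘ f);
  ls_ore : forall (X Y X' : A) (f : mor X Y) (s : mor X X'), S X X' s ->
    exists (Y' : A) (f' : mor X' Y') (s' : mor Y Y'),
      S Y Y' s' /\ s' ∘ f = f' ∘ s;
  ls_cancel : forall (X X' Y : A) (s : mor X X') (f : mor X' Y),
    S X X' s -> f ∘ s = 0 -> exists (Y' : A) (s' : mor Y Y'),
      S Y Y' s' /\ s' ∘ f = 0 }.

Section LeftFractions.
Variables (k : fieldType) (A : kcat k) (S : forall X Y : A, mor X Y -> Prop).
Hypothesis HS : left_system S.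
Arguments S {X Y}.
Implicit Types X Y Z W : A.

Lemma ls_coequalize X X' Y (s : mor X X') (f g : mor X' Y) :
  S s -> f ∘ s = g ∘ s ->
  exists (Y' : A) (r : mor Y Y'), S r /\ r ∘ f = r ∘ g.
Proof.
move=> Ss fg; have [|Y' [r [Sr r0]]] := ls_cancel HS (f := f - g) Ss.
  by rewrite compBm fg subrr.
by exists Y', r; split=> //; apply/subr0_eq; rewrite -compmB.
Qed.

Lemma frac_equiv_refl X Y (p : cospan X Y) : S (den p) -> frac_equiv (@S) p p.
Proof.
by move=> Sp; exists (roof p), (idm _), (idm _); rewrite !comp1m.
Qed.

Lemma frac_equiv_sym X Y (p q : cospan X Y) :
  frac_equiv (@S) p q -> frac_equiv (@S) q p.
Proof. by move=> [W [h [h' [e1 e2 Sh]]]]; exists W, h', h; rewrite -e2. Qed.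

(** An Ore square over den q makes the two comparison maps out of the roof of q
    agree on den q, hence agree after one more denominator. *)
Lemma frac_equiv_trans X Y (p q r : cospan X Y) : S (den q) ->
  frac_equiv (@S) p q -> frac_equiv (@S) q r -> frac_equiv (@S) p r.
Proof.
move=> Sq [W [h1 [h2 [hn hd Sh]]]] [W' [k1 [k2 [kn kd Sk]]]].
have [V [b [a [Sa ab]]]] := ls_ore HS (h2 ∘ den q) Sk.
have [|V' [c [Sc cab]]] := @ls_coequalize _ _ _ (den q) (a ∘ h2) (b ∘ k1) Sq.
  by rewrite -compA ab compA.
exists V', (c ∘ a ∘ h1), (c ∘ b ∘ k2); split.
- by have := compr_eq (num q) cab; rewrite -!compA hn -kn.
- by have := compr_eq (den q) cab; rewrite -!compA hd -kd.
- by rewrite -!compA; apply: (ls_comp HS) => //; apply: (ls_comp HS).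
Qed.

Lemma frac_equivP X Y (p q : cospan X Y) : S (den p) -> S (den q) ->
  frac_class (@S) p = frac_class (@S) q <-> frac_equiv (@S) p q.
Proof.
move=> Sp Sq; split=> [pq|pq].
  have : frac_class (@S) q q by split=> //; apply: frac_equiv_refl.
  by rewrite -pq => -[].
apply/seteqP; split=> r [Sr]; split=> //.
  exact: frac_equiv_trans Sp (frac_equiv_sym pq) _.
exact: frac_equiv_trans Sq pq _.
Qed.

Local Notation Lh := (loc_hom (@S)).

Lemma loc_hom_inj X Y (a b : Lh X Y) : sval a = sval b -> a = b.
Proof. by case: a b => [a pa] [b pb] /= ab; apply: eq_exist. Qed.

(** Classes are handled through their representing fractions, so that no proof
    depends on a chosen representative. *)
Definition represents X Y Y' (a : Lh X Y) (f : mor X Y') (s : mor Y Y') : Prop :=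
  S s /\ sval a = frac_class (@S) (Cospan f s).

Lemma fraction_exists X Y Y' (f : mor X Y') (s : mor Y Y') :
  S s -> exists a : Lh X Y, represents a f s.
Proof.
move=> Ss; unshelve eexists; last split=> //.
  by exists (frac_class (@S) (Cospan f s)); exists (Cospan f s).
by [].
Qed.

Lemma represents_ex X Y (a : Lh X Y) :
  exists (Y' : A) (f : mor X Y') (s : mor Y Y'), represents a f s.
Proof. by case: a => c [[Y' f s] Ss cE]; exists Y', f, s. Qed.

Lemma represents_inj X Y Y' (a b : Lh X Y) (f : mor X Y') (s : mor Y Y') :
  represents a f s -> represents b f s -> a = b.
Proof. by move=> [_ aE] [_ bE]; apply: loc_hom_inj; rewrite aE. Qed.

Lemma represents_change X Y Y' Y'' (a : Lh X Y) (f : mor X Y') (s : mor Y Y')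
    (f' : mor X Y'') (s' : mor Y Y'') :
  represents a f s -> S s' -> frac_equiv (@S) (Cospan f s) (Cospan f' s') ->
  represents a f' s'.
Proof.
by move=> [Ss aE] Ss' e; split=> //; rewrite aE; apply/frac_equivP.
Qed.

Lemma represents_frac_equiv X Y Y' Y'' (a : Lh X Y) (f : mor X Y')
    (s : mor Y Y') (f' : mor X Y'') (s' : mor Y Y'') :
  represents a f s -> represents a f' s' ->
  frac_equiv (@S) (Cospan f s) (Cospan f' s').
Proof. by move=> [Ss aE] [Ss']; rewrite aE => /frac_equivP; apply. Qed.

Lemma represents_expand X Y Y' W (a : Lh X Y) (f : mor X Y') (s : mor Y Y')
    (h : mor Y' W) :
  represents a f s -> S (h ∘ s) -> represents a (h ∘ f) (h ∘ s).
Proof.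
move=> ra Shs; apply: (represents_change ra Shs).
by exists W, h, (idm W); rewrite /= !comp1m.
Qed.

(** Two comparison maps out of the same roof agree on the denominator, so they
    may be taken equal. *)
Lemma represents_same X Y Y' (a : Lh X Y) (f f' : mor X Y') (s : mor Y Y') :
  represents a f s -> represents a f' s ->
  exists (W : A) (h : mor Y' W), h ∘ f = h ∘ f' /\ S (h ∘ s).
Proof.
move=> ra ra'; have Ss := ra.1.
have [W [h [h' /= [hf hs Shs]]]] := represents_frac_equiv ra ra'.
have [V [r [Sr rh]]] := ls_coequalize Ss hs.
exists V, (r ∘ h); split; first by rewrite -compA hf compA -rh.
by rewrite -compA; apply: (ls_comp HS).
Qed.

Lemma common_denominator Y Y1 Y2 (s1 : mor Y Y1) (s2 : mor Y Y2) :
  S s1 -> S s2 -> exists (W : A) (h1 : mor Y1 W) (h2 : mor Y2 W),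
    h1 ∘ s1 = h2 ∘ s2 /\ S (h1 ∘ s1).
Proof.
move=> S1 S2; have [W [h2 [h1 [Sh1 e]]]] := ls_ore HS s1 S2.
by exists W, h1, h2; split=> //; apply: (ls_comp HS).
Qed.

Lemma represents_common X X' Y (a : Lh X Y) (b : Lh X' Y) :
  exists (Y' : A) (f : mor X Y') (f' : mor X' Y') (s : mor Y Y'),
    represents a f s /\ represents b f' s.
Proof.
have [Y1 [f1 [s1 r1]]] := represents_ex a.
have [Y2 [f2 [s2 r2]]] := represents_ex b.
have [W [h1 [h2 [e Se]]]] := common_denominator r1.1 r2.1.
exists W, (h1 ∘ f1), (h2 ∘ f2), (h1 ∘ s1); split.
  exact: represents_expand.
by rewrite e; apply: represents_expand => //; rewrite -e.
Qed.

Lemma represents_common3 X Y (a b c : Lh X Y) :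
  exists (Y' : A) (f g h : mor X Y') (s : mor Y Y'),
    [/\ represents a f s, represents b g s & represents c h s].
Proof.
have [Y1 [f1 [g1 [s1 [rf rg]]]]] := represents_common a b.
have [Y2 [f2 [s2 r2]]] := represents_ex c.
have [W [h1 [h2 [e Se]]]] := common_denominator rf.1 r2.1.
exists W, (h1 ∘ f1), (h1 ∘ g1), (h2 ∘ f2), (h1 ∘ s1).
split; try exact: represents_expand.
by rewrite e; apply: represents_expand => //; rewrite -e.
Qed.

(** Any operation on numerators which commutes with postcomposition descends to
    fractions: two pairs of numerators over the same denominator become equal
    after one further expansion. *)
Lemma numerator_op_exists X Y
    (op : forall Z, mor X Z -> mor X Z -> mor X Z)
    (op_nat : forall Z W (h : mor Z W) f g,
      h ∘ op Z f g = op W (h ∘ f) (h ∘ g)) (a b : Lh X Y) :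
  exists c : Lh X Y, forall Y' (f g : mor X Y') (s : mor Y Y'),
    represents a f s -> represents b g s -> represents c (op Y' f g) s.
Proof.
have [Y0 [f0 [g0 [s0 [af0 bg0]]]]] := represents_common a b.
have [c rc] := fraction_exists (op Y0 f0 g0) af0.1.
exists c => Y' f g s af bg; apply: (represents_change rc af.1).
have [W [h0 [h [e Se]]]] := common_denominator af0.1 af.1.
have af' : represents a (h ∘ f) (h0 ∘ s0).
  by rewrite e; apply: represents_expand => //; rewrite -e.
have [W1 [l [lf Sl]]] := represents_same (represents_expand af0 Se) af'.
rewrite compA in Sl.
have el : l ∘ h0 ∘ s0 = l ∘ h ∘ s by rewrite -!compA e.
have bg' : represents b (l ∘ h ∘ g) (l ∘ h0 ∘ s0).
  by rewrite el; apply: represents_expand => //; rewrite -el.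
have [W2 [l2 [lg Sl2]]] := represents_same (represents_expand bg0 Sl) bg'.
exists W2, (l2 ∘ (l ∘ h0)), (l2 ∘ (l ∘ h)) => /=; split.
- by rewrite !op_nat -!compA in lf lg *; rewrite lf lg.
- by rewrite -!compA e.
- by rewrite -compA.
Qed.

Definition numerator_op X Y (op : forall Z, mor X Z -> mor X Z -> mor X Z)
    op_nat (a b : Lh X Y) : Lh X Y :=
  sval (cid (@numerator_op_exists X Y op op_nat a b)).

Lemma numerator_opP X Y (op : forall Z, mor X Z -> mor X Z -> mor X Z) op_nat (a b : Lh X Y) Y' (f g : mor X Y')
    (s : mor Y Y') : represents a f s -> represents b g s ->
  represents (numerator_op (op := op) op_nat a b) (op Y' f g) s.
Proof. by rewrite /numerator_op; case: cid => c /= cP; apply: cP. Qed.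

Definition frac_add X Y (a b : Lh X Y) : Lh X Y :=
  numerator_op (fun Z W h f g => @compmD k A X Z W h f g) a b.
Definition frac_opp X Y (a : Lh X Y) : Lh X Y :=
  numerator_op (op := fun Z f _ => - f)
    (fun Z W h f _ => @compmN k A X Z W h f) a a.
Definition frac_scale (l : k) X Y (a : Lh X Y) : Lh X Y :=
  numerator_op (op := fun Z f _ => l *: f)
    (fun Z W h f _ => @compmZ k A X Z W h l f) a a.
Definition frac_zero X Y : Lh X Y :=
  sval (cid (fraction_exists (0 : mor X Y) (ls_id HS Y))).

Lemma frac_zeroP X Y Y' (s : mor Y Y') :
  S s -> represents (frac_zero X Y) 0 s.
Proof.
move=> Ss; rewrite /frac_zero; case: cid => a /= ra.
have := represents_expand ra (h := s); rewrite compm0 compm1; exact.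
Qed.

Lemma frac_addP X Y (a b : Lh X Y) Y' (f g : mor X Y') (s : mor Y Y') :
  represents a f s -> represents b g s -> represents (frac_add a b) (f + g) s.
Proof. exact: numerator_opP. Qed.

Lemma frac_oppP X Y (a : Lh X Y) Y' (f : mor X Y') (s : mor Y Y') :
  represents a f s -> represents (frac_opp a) (- f) s.
Proof.
by move=> ra; apply: (numerator_opP (op := fun Z f _ => - f) _ ra ra).
Qed.

Lemma frac_scaleP l X Y (a : Lh X Y) Y' (f : mor X Y') (s : mor Y Y') :
  represents a f s -> represents (frac_scale l a) (l *: f) s.
Proof.
by move=> ra; apply: (numerator_opP (op := fun Z f _ => l *: f) _ ra ra).
Qed.

Lemma frac_addA X Y : associative (@frac_add X Y).
Proof.
move=> a b c; have [Y' [f [g [h [s [rf rg rh]]]]]] := represents_common3 a b c.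
apply: (represents_inj (f := f + (g + h)) (s := s)).
  by do 2 apply: frac_addP => //.
by rewrite addrA; do 2 apply: frac_addP => //.
Qed.

Lemma frac_addC X Y : commutative (@frac_add X Y).
Proof.
move=> a b; have [Y' [f [g [s [rf rg]]]]] := represents_common a b.
apply: (represents_inj (f := f + g) (s := s)); first exact: frac_addP.
by rewrite addrC; apply: frac_addP.
Qed.

Lemma frac_add0 X Y : left_id (frac_zero X Y) (@frac_add X Y).
Proof.
move=> a; have [Y' [f [s rf]]] := represents_ex a.
apply: (represents_inj (f := f) (s := s)) => //.
by rewrite -[f]add0r; apply: frac_addP => //; apply: frac_zeroP rf.1.
Qed.

Lemma frac_addN X Y : left_inverse (frac_zero X Y) (@frac_opp X Y) (@frac_add X Y).
Proof.
move=> a; have [Y' [f [s rf]]] := represents_ex a.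
apply: (represents_inj (f := 0) (s := s)); last exact: frac_zeroP rf.1.
by rewrite -(addNr f); apply: frac_addP => //; apply: frac_oppP.
Qed.

Lemma frac_scaleA X Y l l' (a : Lh X Y) :
  frac_scale l (frac_scale l' a) = frac_scale (l * l') a.
Proof.
have [Y' [f [s rf]]] := represents_ex a.
apply: (represents_inj (f := (l * l') *: f) (s := s)); last exact: frac_scaleP.
by rewrite -scalerA; do 2 apply: frac_scaleP.
Qed.

Lemma frac_scale1 X Y : left_id 1 (fun l => @frac_scale l X Y).
Proof.
move=> a; have [Y' [f [s rf]]] := represents_ex a.
apply: (represents_inj (f := f) (s := s)) => //.
by rewrite -[f]scale1r; apply: frac_scaleP.
Qed.

Lemma frac_scaleDr X Y :
  right_distributive (fun l => @frac_scale l X Y) (@frac_add X Y).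
Proof.
move=> l a b; have [Y' [f [g [s [rf rg]]]]] := represents_common a b.
apply: (represents_inj (f := l *: (f + g)) (s := s)).
  by apply: frac_scaleP; apply: frac_addP.
by rewrite scalerDr; apply: frac_addP; apply: frac_scaleP.
Qed.

Lemma frac_scaleDl X Y (a : Lh X Y) l l' :
  frac_scale (l + l') a = frac_add (frac_scale l a) (frac_scale l' a).
Proof.
have [Y' [f [s rf]]] := represents_ex a.
apply: (represents_inj (f := (l + l') *: f) (s := s)); first exact: frac_scaleP.
by rewrite scalerDl; apply: frac_addP; apply: frac_scaleP.
Qed.

(** Any two composites of representatives agree: over a common denominator the
    numerators of b are made equal first; the resulting two maps out of roofs of
    a then agree on the denominator of a, hence after a further denominator. *)
Lemma frac_comp_exists X Y Z (b : Lh Y Z) (a : Lh X Y) :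
  exists c : Lh X Z, forall Y' Z' W (f : mor X Y') (g : mor Y Y')
    (f' : mor Y Z') (g' : mor Z Z') (h : mor Y' W) (h' : mor Z' W),
    represents a f g -> represents b f' g' -> S h' -> h ∘ g = h' ∘ f' ->
    represents c (h ∘ f) (h' ∘ g').
Proof.
have [Y0 [f0 [g0 ra0]]] := represents_ex a.
have [Z0 [f0' [g0' rb0]]] := represents_ex b.
have [W0 [h0 [h0' [Sh0' e0]]]] := ls_ore HS f0' ra0.1.
have [c rc] := fraction_exists (h0 ∘ f0) (ls_comp HS Sh0' rb0.1).
exists c => Y' Z' W f g f' g' h h' ra rb Sh' e.
have Sg' : S (h' ∘ g') := ls_comp HS Sh' rb.1.
apply: (represents_change rc Sg').
(* Bring both composites to one denominator on which the numerators of b agree. *)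
have [W1 [p0 [p [ep Sp]]]] := common_denominator rc.1 Sg'.
rewrite !compA in ep Sp.
have rb0' := represents_expand rb0 Sp.
have rb' : represents b (p ∘ h' ∘ f') (p0 ∘ h0' ∘ g0').
  by rewrite ep; apply: represents_expand => //; rewrite -ep.
have [W2 [r [er Sr]]] := represents_same rb0' rb'.
have eg : r ∘ p0 ∘ h0 ∘ g0 = r ∘ p ∘ h ∘ g.
  by rewrite -!compA -e0 e !compA; rewrite !compA in er.
have [W3 [q0 [q [qf qg /= Sq]]]] := represents_frac_equiv ra0 ra.
rewrite /= in qf qg.
have [V [x [d [Sd ed]]]] := ls_ore HS (r ∘ p0 ∘ h0 ∘ g0) Sq.
have [|V1 [d1 [Sd1 e1]]] :=
  @ls_coequalize _ _ _ g0 (d ∘ (r ∘ p0 ∘ h0)) (x ∘ q0) ra0.1.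
  by rewrite -!compA in ed *.
have [|V2 [d2 [Sd2 e2]]] :=
  @ls_coequalize _ _ _ g (d1 ∘ d ∘ (r ∘ p ∘ h)) (d1 ∘ x ∘ q) ra.1.
  by rewrite -!compA in eg ed *; rewrite -eg ed qg.
have Sdd : S (d2 ∘ d1 ∘ d) by do 2 apply: (ls_comp HS) => //.
exists V2, (d2 ∘ d1 ∘ d ∘ r ∘ p0), (d2 ∘ d1 ∘ d ∘ r ∘ p) => /=; split.
- have -> : d2 ∘ d1 ∘ d ∘ r ∘ p0 ∘ (h0 ∘ f0) = d2 ∘ (d1 ∘ (d ∘ (r ∘ p0 ∘ h0))) ∘ f0.
    by rewrite !compA.
  have -> : d2 ∘ d1 ∘ d ∘ r ∘ p ∘ (h ∘ f) = d2 ∘ (d1 ∘ d ∘ (r ∘ p ∘ h)) ∘ f.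
    by rewrite !compA.
  by rewrite e1 e2 -!compA qf.
- by rewrite -!compA in ep *; rewrite ep.
- have -> : d2 ∘ d1 ∘ d ∘ r ∘ p0 ∘ (h0' ∘ g0')
            = d2 ∘ d1 ∘ d ∘ (r ∘ (p0 ∘ h0' ∘ g0')) by rewrite !compA.
  exact: (ls_comp HS).
Qed.

Definition frac_comp X Y Z (b : Lh Y Z) (a : Lh X Y) : Lh X Z :=
  sval (cid (frac_comp_exists b a)).

Lemma frac_compP X Y Z (b : Lh Y Z) (a : Lh X Y) Y' Z' W
    (f : mor X Y') (g : mor Y Y') (f' : mor Y Z') (g' : mor Z Z')
    (h : mor Y' W) (h' : mor Z' W) :
  represents a f g -> represents b f' g' -> S h' -> h ∘ g = h' ∘ f' ->
  represents (frac_comp b a) (h ∘ f) (h' ∘ g').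
Proof. by rewrite /frac_comp; case: cid => c /= cP; apply: cP. Qed.

Definition frac_of X Y (f : mor X Y) : Lh X Y :=
  sval (cid (fraction_exists f (ls_id HS Y))).

Lemma frac_ofP X Y (f : mor X Y) : represents (frac_of f) f (idm Y).
Proof. by rewrite /frac_of; case: cid. Qed.

Lemma frac_comp_of X Y Z (b : Lh Y Z) (f : mor X Y) Z' (g : mor Y Z')
    (s : mor Z Z') : represents b g s ->
  represents (frac_comp b (frac_of f)) (g ∘ f) s.
Proof.
move=> rb; rewrite -[s]comp1m; apply: (frac_compP (frac_ofP f) rb).
  exact: ls_id.
by rewrite compm1 comp1m.
Qed.

Lemma frac_of_comp X Y Z (g : mor Y Z) (a : Lh X Y) Y' Z'
    (f : mor X Y') (s : mor Y Y') (h : mor Y' Z') (h' : mor Z Z') :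
  represents a f s -> S h' -> h ∘ s = h' ∘ g ->
  represents (frac_comp (frac_of g) a) (h ∘ f) h'.
Proof.
by move=> ra Sh' e; rewrite -[h']compm1; apply: (frac_compP ra (frac_ofP g)).
Qed.

Lemma frac_comp1m X Y (a : Lh X Y) : frac_comp (frac_of (idm Y)) a = a.
Proof.
have [Y' [f [s ra]]] := represents_ex a.
apply: (represents_inj (f := f) (s := s)) => //.
rewrite -[f]comp1m; apply: (frac_of_comp ra ra.1).
by rewrite comp1m compm1.
Qed.

Lemma frac_compm1 X Y (a : Lh X Y) : frac_comp a (frac_of (idm X)) = a.
Proof.
have [Y' [f [s ra]]] := represents_ex a.
apply: (represents_inj (f := f) (s := s)) => //.
by rewrite -[f]compm1; apply: frac_comp_of.
Qed.

Lemma frac_compA X Y Z T (c : Lh Z T) (b : Lh Y Z) (a : Lh X Y) :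
  frac_comp c (frac_comp b a) = frac_comp (frac_comp c b) a.
Proof.
have [Y' [f [g ra]]] := represents_ex a.
have [Z' [f' [g' rb]]] := represents_ex b.
have [T' [f'' [g'' rc]]] := represents_ex c.
have [W [h [h' [Sh' e]]]] := ls_ore HS f' ra.1.
have [V [l [l' [Sl' e']]]] := ls_ore HS f'' (ls_comp HS Sh' rb.1).
have rba := frac_compP ra rb Sh' (esym e).
have rcba := frac_compP rba rc Sl' (esym e').
apply: (represents_inj rcba).
have rcb : represents (frac_comp c b) (l ∘ h' ∘ f') (l' ∘ g'').
  by apply: (frac_compP rb rc Sl'); rewrite -compA e'.
rewrite compA -[l' ∘ g'']comp1m; apply: (frac_compP ra rcb (ls_id HS _)).
by rewrite comp1m -!compA e.
Qed.

Lemma frac_comp_linl X Y Z (a : Lh X Y) (l : k) (b b' : Lh Y Z) :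
  frac_comp (frac_add (frac_scale l b) b') a
  = frac_add (frac_scale l (frac_comp b a)) (frac_comp b' a).
Proof.
have [Y' [f [g ra]]] := represents_ex a.
have [Z' [f' [f'' [g' [rb rb']]]]] := represents_common b b'.
have [W1 [h1 [h1' [Sh1 e1]]]] := ls_ore HS f' ra.1.
have [W2 [h2 [h2' [Sh2 e2]]]] := ls_ore HS (h1' ∘ f'') ra.1.
have Sh : S (h2' ∘ h1') := ls_comp HS Sh2 Sh1.
have e : h2' ∘ h1 ∘ g = h2' ∘ h1' ∘ f' by rewrite -!compA e1.
have e' : h2 ∘ g = h2' ∘ h1' ∘ f'' by rewrite -e2 compA.
apply: (represents_inj (f := (l *: (h2' ∘ h1) + h2) ∘ f)
                       (s := h2' ∘ h1' ∘ g')).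
  apply: (frac_compP (f' := l *: f' + f'') ra _ Sh).
    by apply: frac_addP => //; apply: frac_scaleP.
  by rewrite comp_linl comp_linr e e'.
rewrite comp_linl; apply: frac_addP; last exact: frac_compP ra rb' Sh e'.
by apply: frac_scaleP; exact: (frac_compP ra rb Sh e).
Qed.

Lemma frac_comp_linr X Y Z (b : Lh Y Z) (l : k) (a a' : Lh X Y) :
  frac_comp b (frac_add (frac_scale l a) a')
  = frac_add (frac_scale l (frac_comp b a)) (frac_comp b a').
Proof.
have [Y' [f1 [f2 [g [ra ra']]]]] := represents_common a a'.
have [Z' [f' [g' rb]]] := represents_ex b.
have [W [h [h' [Sh e]]]] := ls_ore HS f' ra.1; move/esym in e.
apply: (represents_inj (f := h ∘ (l *: f1 + f2)) (s := h' ∘ g')).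
  apply: (frac_compP _ rb Sh e).
  by apply: frac_addP => //; apply: frac_scaleP.
rewrite comp_linr; apply: frac_addP; last exact: frac_compP ra' rb Sh e.
by apply: frac_scaleP; exact: (frac_compP ra rb Sh e).
Qed.

End LeftFractions.

(** Naming the type of fractions after the proof that denominators form a left
    system lets its module structure be found by type inference. *)
Definition frac_hom (k : fieldType) (A : kcat k)
    (S : forall X Y : A, mor X Y -> Prop) (HS : left_system S) (X Y : A) : Type :=
  loc_hom S X Y.

Section FractionCategory.
Variables (k : fieldType) (A : kcat k) (S : forall X Y : A, mor X Y -> Prop).
Hypothesis HS : left_system S.

HB.instance Definition _ X Y := gen_eqMixin (frac_hom HS X Y).
HB.instance Definition _ X Y := gen_choiceMixin (frac_hom HS X Y).
HB.instance Definition _ X Y := GRing.isZmodule.Build (frac_hom HS X Y)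
  (@frac_addA k A S HS X Y) (@frac_addC k A S HS X Y)
  (@frac_add0 k A S HS X Y) (@frac_addN k A S HS X Y).
HB.instance Definition _ X Y :=
  GRing.Zmodule_isLmodule.Build k (frac_hom HS X Y)
  (fun l l' a => @frac_scaleA k A S HS X Y l l' a) (@frac_scale1 k A S HS X Y)
  (@frac_scaleDr k A S HS X Y) (@frac_scaleDl k A S HS X Y).

Definition frac_module (X Y : A) : GRing.Lmodule.axioms_ k (loc_hom S X Y) :=
  GRing.Lmodule.class (frac_hom HS X Y : lmodType k).

Definition frac_mixin :
    kcat_mixin (fun X Y : A => GRing.Lmodule.Pack (frac_module X Y)) :=
  @KCatMixin k A (fun X Y : A => GRing.Lmodule.Pack (frac_module X Y))
    (fun X => frac_of HS (idm X)) (@frac_comp k A S HS)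
    (@frac_comp1m k A S HS) (@frac_compm1 k A S HS) (@frac_compA k A S HS)
    (@frac_comp_linl k A S HS) (@frac_comp_linr k A S HS).

Lemma frac_mixin_fraction : fraction_category frac_mixin.
Proof.
split.
- move=> X Y; split=> [p Sp|p q _ _|p q r _ Sq _].
  + exact: frac_equiv_refl.
  + exact: frac_equiv_sym.
  + exact: (frac_equiv_trans HS Sq).
- by move=> X; apply: (frac_ofP HS (idm X)).2.
- move=> X Y Z a b Y' Z' W f g f' g' h h' Sg Sg' Sh' aE bE e.
  exact: (frac_compP HS (conj Sg aE) (conj Sg' bE) Sh' e).2.
Qed.

Definition frac_functor :
    @functor_mixin k A (KCat frac_mixin) (fun X : A => X).
Proof.
apply: (@FunctorMixin k A (KCat frac_mixin) (fun X : A => X)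
  (fun X Y => @frac_of k A S HS X Y)).
  by [].
move=> X Y Z g f; apply: represents_inj (frac_ofP HS _) _.
exact: (frac_comp_of HS f (frac_ofP HS g)).
Defined.

Local Notation B := (KCat frac_mixin).
Local Notation Q := (frac_of HS).

Lemma frac_of_linear X Y (a : k) (f g : mor X Y) :
  Q (a *: f + g) = a *: (Q f : @mor k B X Y) + Q g.
Proof.
apply: represents_inj (frac_ofP HS _) _.
by apply: frac_addP; [apply: frac_scaleP|]; apply: frac_ofP.
Qed.

Lemma frac_of_iso (X Y : A) (s : mor X Y) :
  S s -> is_iso (Q s : @mor k B X Y).
Proof.
move=> Ss; have [a ra] := fraction_exists (idm Y) Ss.
exists a; split.
  apply: represents_inj (frac_comp_of HS s ra) _.
  rewrite comp1m -[s in represents _ s _]compm1 -[s in represents _ _ s]compm1.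
  by apply: represents_expand (frac_ofP HS (idm X)) _ => //; rewrite compm1.
have := frac_of_comp HS ra (ls_id HS Y) (erefl (idm Y ∘ s)); rewrite comp1m => r.
exact: represents_inj r (frac_ofP HS _).
Qed.

Lemma frac_of_decomp (X Y : A) (a : @mor k B X Y) :
  exists (Y' : A) (f : mor X Y') (s : mor Y Y'),
    S s /\ (Q s : @mor k B Y Y') ∘ a = Q f.
Proof.
have [Y' [f [s ra]]] := represents_ex a; exists Y', f, s; split; first exact: ra.1.
have := frac_of_comp HS ra (ls_id HS Y') (erefl (idm Y' ∘ s)); rewrite comp1m => r.
exact: represents_inj r (frac_ofP HS _).
Qed.

Lemma frac_of_eq0 (X Y : A) (f : mor X Y) :
  Q f = (0 : @mor k B X Y) -> exists (Y' : A) (s : mor Y Y'), S s /\ s ∘ f = 0.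
Proof.
move=> f0; have := frac_zeroP HS X (ls_id HS Y); rewrite -[frac_zero _ _ _]f0 => r0.
have [Y' [s [sf]]] := represents_same HS (frac_ofP HS f) r0.
by rewrite compm1 compm0 in sf *; exists Y', s.
Qed.

End FractionCategory.

(** * Exact triangles and the five lemma *)

Section WeakCokernels.
Variables (k : fieldType) (A : kcat k).
Implicit Types X Y Z W : A.

Definition weak_coker X Y Z (f : mor X Y) (g : mor Y Z) : Prop :=
  g ∘ f = 0 /\
  forall W (u : mor Y W), u ∘ f = 0 -> exists v : mor Z W, u = v ∘ g.

Lemma weak_coker_iso X Y Z X' Y' Z' (f : mor X Y) (g : mor Y Z)
    (f' : mor X' Y') (g' : mor Y' Z') (a : mor X X') (b : mor Y Y')
    (c : mor Z Z') :
  is_iso a -> is_iso b -> is_iso c -> b ∘ f = f' ∘ a -> c ∘ g = g' ∘ b ->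
  weak_coker f' g' -> weak_coker f g.
Proof.
move=> ia ib ic bf cg [gf0 fact]; split.
  by apply: (iso_lcancel ic); rewrite compA cg -compA bf compA gf0 comp0m compm0.
move=> W u uf; have [b' [b'b bb']] := ib.
have [|v uv] := fact W (u ∘ b').
  by apply: (iso_rcancel ia); rewrite -!compA -bf (compA b') b'b comp1m uf comp0m.
exists (v ∘ c); apply: (iso_rcancel (f := b')); first by exists b.
by rewrite uv -!compA (compA c) cg -!compA bb' compm1.
Qed.

Lemma weak_cokerN X Y Z (f : mor X Y) (g : mor Y Z) :
  weak_coker f (- g) -> weak_coker f g.
Proof.
move=> [gf fact]; split.
  by apply: oppr_inj; rewrite -compNm gf oppr0.
by move=> W u /fact [v ->]; exists (- v); rewrite compNm compmN.
Qed.

(** These are the consequences of the axioms of a triangle that make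
    Hom(-, W) exact on it, for all W; they suffice for the five lemma. *)
Definition exact_tri (F : functor A A) X Y Z (f : mor X Y) (g : mor Y Z)
    (h : mor Z (F X)) : Prop :=
  [/\ weak_coker f g, weak_coker g h & weak_coker h (fmap F f)].

Variable F : functor A A.

(** Diagram chase with morphisms into an arbitrary object; a left inverse e of
    c is built first, and then [c ∘ e - 1] vanishes as it kills c. *)
Lemma five_lemma X Y Z X' Y' Z' (f : mor X Y) (g : mor Y Z) (h : mor Z (F X))
    (f' : mor X' Y') (g' : mor Y' Z') (h' : mor Z' (F X'))
    (a : mor X X') (b : mor Y Y') (c : mor Z Z') :
  exact_tri f g h -> exact_tri f' g' h' -> is_iso a -> is_iso b ->
  b ∘ f = f' ∘ a -> c ∘ g = g' ∘ b -> fmap F a ∘ h = h' ∘ c -> is_iso c.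
Proof.
move=> [fg gh hF] [fg' gh' hF'] ia ib bf cg ah.
have [a' [a'a aa']] := ia; have [b' [b'b bb']] := ib.
have f'a' : f ∘ a' = b' ∘ f'.
  by apply: (iso_lcancel ib); rewrite compA bf -compA aa' compm1 compA bb' comp1m.
have kill W (v : mor Z' W) : v ∘ c = 0 -> v = 0.
  move=> vc; have [|w vE] := gh'.2 W v.
    by apply: (iso_rcancel ib); rewrite -compA -cg compA vc !comp0m.
  have [|x wE] := hF.2 _ (w ∘ fmap F a).
    by rewrite -compA ah compA -vE.
  have {}wE : w = x ∘ fmap F b' ∘ fmap F f'.
    by rewrite -compA -fmapM -f'a' fmapM compA -wE -compA -fmapM aa' fmap1 compm1.
  by rewrite vE wE -compA hF'.1 compm0.
have [e ec] : exists e : mor Z' Z, e ∘ c = idm Z.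
  have [|v vE] := fg'.2 _ (g ∘ b').
    by rewrite -compA -f'a' compA fg.1 comp0m.
  have [|w wE] := gh.2 _ (idm Z - v ∘ c).
    by rewrite compBm comp1m -compA cg compA -vE -compA b'b compm1 subrr.
  exists (v + w ∘ fmap F a' ∘ h').
  rewrite compDm -!compA -ah (compA (fmap F a')) -fmapM a'a fmap1 comp1m -wE.
  by rewrite addrC subrK.
exists e; split=> //; apply/subr0_eq; apply: kill.
by rewrite compBm -compA ec compm1 comp1m subrr.
Qed.

Lemma exact_tri_iso X Y Z X' Y' Z' (f : mor X Y) (g : mor Y Z) (h : mor Z (F X))
    (f' : mor X' Y') (g' : mor Y' Z') (h' : mor Z' (F X'))
    (a : mor X X') (b : mor Y Y') (c : mor Z Z') :
  is_iso a -> is_iso b -> is_iso c ->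
  b ∘ f = f' ∘ a -> c ∘ g = g' ∘ b -> fmap F a ∘ h = h' ∘ c ->
  exact_tri f' g' h' -> exact_tri f g h.
Proof.
move=> ia ib ic bf cg ah [fg gh hF].
have iFa := iso_fmap F ia; have iFb := iso_fmap F ib.
split; [exact: weak_coker_iso ia ib ic _ _ fg|exact: weak_coker_iso ib ic iFa _ _ gh|].
by apply: (weak_coker_iso ic iFa iFb ah _ hF); rewrite -!fmapM bf.
Qed.

End WeakCokernels.

Section Triangles.
Variables (k : fieldType) (A : tricat k).
Implicit Types X Y Z W : A.
Local Notation sh := (fmap (susp A)).

Lemma susp_lin : klinear (susp A).
Proof. exact: susp_linear_. Qed.

Definition sh0 X Y : sh (0 : mor X Y) = 0 := fmap0 susp_lin X Y.
Lemma sh_inj X Y (f g : mor X Y) : sh f = sh g -> f = g.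
Proof.
have [bij _] := susp_equiv_ (tri_mixin_of A).
by have [i fK _] := bij X Y => /(congr1 i); rewrite !fK.
Qed.

Lemma sh_surj X Y (f : mor X[1] Y[1]) : exists g : mor X Y, f = sh g.
Proof.
have [bij _] := susp_equiv_ (tri_mixin_of A).
by have [i _ Kf] := bij X Y; exists (i f); rewrite [sh _]Kf.
Qed.

Lemma desuspension X : exists (Y : A) (f : mor Y[1] X), is_iso f.
Proof. by have [_ /(_ X)] := susp_equiv_ (tri_mixin_of A). Qed.

Lemma has_sums n (Y : 'I_n -> A) : exists X, direct_sum Y X.
Proof. exact: has_sums_ (tri_mixin_of A) n Y. Qed.

Lemma zero_object : exists X : A, is_zero X.
Proof.
have Y : 'I_0 -> A by case.
have [X sX] := has_sums Y.
by exists X; move/sum0_zero: sX.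
Qed.

Lemma zero_susp X : is_zero X -> is_zero X[1].
Proof. by rewrite /is_zero -fmap1 => ->; apply: sh0. Qed.

Lemma dist_iso X Y Z X' Y' Z' (f : mor X Y) (g : mor Y Z) (h : mor Z X[1])
    (f' : mor X' Y') (g' : mor Y' Z') (h' : mor Z' X'[1])
    (a : mor X X') (b : mor Y Y') (c : mor Z Z') :
  is_iso a -> is_iso b -> is_iso c ->
  b ∘ f = f' ∘ a -> c ∘ g = g' ∘ b -> sh a ∘ h = h' ∘ c ->
  dist f g h -> dist f' g' h'.
Proof. exact: dist_iso_. Qed.

Lemma dist_idm X Z : is_zero Z ->
  dist (idm X) (0 : mor X Z) (0 : mor Z X[1]).
Proof. exact: dist_idm_. Qed.

Lemma dist_cone X Y (f : mor X Y) :
  exists (Z : A) (g : mor Y Z) (h : mor Z X[1]), dist f g h.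
Proof. exact: dist_cone_. Qed.

Lemma dist_rot X Y Z (f : mor X Y) (g : mor Y Z) (h : mor Z X[1]) :
  dist f g h <-> dist g h (- sh f).
Proof. exact: dist_rot_. Qed.

Lemma dist_fill X Y Z X' Y' Z'
    (f : mor X Y) (g : mor Y Z) (h : mor Z X[1])
    (f' : mor X' Y') (g' : mor Y' Z') (h' : mor Z' X'[1])
    (a : mor X X') (b : mor Y Y') :
  dist f g h -> dist f' g' h' -> b ∘ f = f' ∘ a ->
  exists c : mor Z Z', c ∘ g = g' ∘ b /\ sh a ∘ h = h' ∘ c.
Proof. exact: dist_fill_. Qed.

(** Compare with the triangle on the identity of X. *)
Lemma dist_comp0 X Y Z (f : mor X Y) (g : mor Y Z) (h : mor Z X[1]) :
  dist f g h -> g ∘ f = 0.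
Proof.
move=> d; have [T T0] := zero_object.
have [|c [cE _]] := dist_fill (a := idm X) (b := f) (dist_idm X T0) d.
  by [].
by rewrite -cE compm0.
Qed.

(** A map u that kills f extends to a map into the triangle 0 -> W -> W. *)
Lemma dist_weak_coker X Y Z (f : mor X Y) (g : mor Y Z) (h : mor Z X[1]) :
  dist f g h -> weak_coker f g.
Proof.
move=> d; split; first exact: dist_comp0 d.
move=> W u uf; have [T T0] := zero_object.
have dW : dist (0 : mor T W) (idm W) (0 : mor W T[1]).
  by apply/dist_rot; rewrite sh0 oppr0; apply/dist_idm/zero_susp.
have [|v [vE _]] := dist_fill (a := 0 : mor X T) (b := u) d dW.
  by rewrite uf compm0.
by exists v; rewrite vE comp1m.
Qed.

Lemma dist_exact X Y Z (f : mor X Y) (g : mor Y Z) (h : mor Z X[1]) :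
  dist f g h -> exact_tri f g h.
Proof.
move=> d; have d1 := (dist_rot _ _ _).1 d; have d2 := (dist_rot _ _ _).1 d1.
split; [exact: dist_weak_coker d|exact: dist_weak_coker d1|].
exact: weak_cokerN (dist_weak_coker d2).
Qed.

(** The cone of h is a suspension up to isomorphism, and so are the maps of its
    triangle, which can therefore be rotated backwards. *)
Lemma dist_cocone X Z (h : mor Z X[1]) :
  exists (Y : A) (f : mor X Y) (g : mor Y Z), dist f g h.
Proof.
have [W [p [q d]]] := dist_cone h.
have [Y [i ii]] := desuspension W; have [j [ji ij]] := ii.
have [f fE] := sh_surj (- (j ∘ p)); have [g gE] := sh_surj (- (q ∘ i)).
exists Y, f, g; apply/dist_rot/dist_rot; rewrite -fE -gE !opprK.
apply: (dist_iso (a := idm _) (b := idm _) (c := j) _ _ _ _ _ _ d);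
  rewrite ?comp1m ?compm1 ?fmap1 ?comp1m //; try exact: iso_idm.
  by exists i.
by rewrite -compA ij compm1.
Qed.

(** Three rotations change all signs; the sign of the first two maps is absorbed
    by the automorphism -1 of the middle object. *)
Lemma dist_susp X Y Z (f : mor X Y) (g : mor Y Z) (h : mor Z X[1]) :
  dist f g h -> dist (sh f) (sh g) (- sh h).
Proof.
move/dist_rot/dist_rot/dist_rot.
apply: (@dist_iso _ _ _ _ _ _ _ _ _ _ _ _ (idm _) (- idm _) (idm _));
  try exact: iso_idm.
- exact/iso_opp/iso_idm.
- by rewrite compNm compmN comp1m compm1 opprK.
- by rewrite !compmN comp1m compm1.
- by rewrite fmap1 comp1m compm1.
Qed.

Lemma dist_fill_mid X Y Z X' Y' Z'
    (f : mor X Y) (g : mor Y Z) (h : mor Z X[1])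
    (f' : mor X' Y') (g' : mor Y' Z') (h' : mor Z' X'[1])
    (a : mor X X') (c : mor Z Z') :
  dist f g h -> dist f' g' h' -> sh a ∘ h = h' ∘ c ->
  exists b : mor Y Y', b ∘ f = f' ∘ a /\ c ∘ g = g' ∘ b.
Proof.
move=> /dist_rot/dist_rot d /dist_rot/dist_rot d' ah.
have [b' []] := dist_fill d d' ah; have [b ->] := sh_surj b'.
rewrite !compmN !compNm -!fmapM => /oppr_inj/sh_inj bf /oppr_inj/sh_inj cg.
by exists b.
Qed.

Lemma cone_unique X Y Z Z' (f : mor X Y) (g : mor Y Z) (h : mor Z X[1])
    (g' : mor Y Z') (h' : mor Z' X[1]) :
  dist f g h -> dist f g' h' -> exists c : mor Z Z', is_iso c.
Proof.
move=> d d'; have e : idm Y ∘ f = f ∘ idm X by rewrite comp1m compm1.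
have [c [cg ch]] := dist_fill d d' e; exists c.
exact: (five_lemma (dist_exact d) (dist_exact d') (iso_idm X) (iso_idm Y)).
Qed.

(** ** Morphisms whose cone lies in a triangulated subcategory *)

Record tri_subcat (P : A -> Prop) : Prop := TriSubcat {
  ts_zero : forall X, is_zero X -> P X;
  ts_susp : forall X, P X -> P X[1];
  ts_desusp : forall X, P X[1] -> P X;
  ts_ext : forall X Y Z (f : mor X Y) (g : mor Y Z) (h : mor Z X[1]),
    dist f g h -> P X -> P Z -> P Y }.

Definition cone_in (P : A -> Prop) X Y (f : mor X Y) : Prop :=
  exists (Z : A) (g : mor Y Z) (h : mor Z X[1]), dist f g h /\ P Z.

Variable P : A -> Prop.
Hypothesis HP : tri_subcat P.

Lemma ts_iso X Y (f : mor X Y) : is_iso f -> P X -> P Y.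
Proof.
move=> i PX; have [T T0] := zero_object.
suff d : dist f (0 : mor Y T) (0 : mor T X[1]).
  exact: (ts_ext HP d PX (ts_zero HP T0)).
apply: (dist_iso (a := idm X) (b := f) (c := idm T) _ _ _ _ _ _ (dist_idm X T0));
  rewrite ?compm0 ?comp0m ?compm1 //; exact: iso_idm.
Qed.

Lemma cone_inP X Y Z (f : mor X Y) (g : mor Y Z) (h : mor Z X[1]) :
  dist f g h -> cone_in P f -> P Z.
Proof.
move=> d [Z' [g' [h' [d' PZ]]]].
by have [c ic] := cone_unique d' d; apply: ts_iso ic PZ.
Qed.

Lemma cone_in_susp X Y (f : mor X Y) : cone_in P f -> cone_in P (sh f).
Proof.
move=> [Z [g [h [d PZ]]]]; exists Z[1], (sh g), (- sh h).
by split; [apply: dist_susp|apply: ts_susp].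
Qed.

(** Since every object is a suspension up to isomorphism, a denominator out of
    Y[1] is essentially the suspension of one out of Y. *)
Lemma cone_in_desusp Y W (r : mor Y[1] W) : cone_in P r ->
  exists (W' : A) (s : mor Y W') (i : mor W'[1] W),
    [/\ cone_in P s, is_iso i & r = i ∘ sh s].
Proof.
move=> Pr; have [W' [i ii]] := desuspension W; have [j [ji ij]] := ii.
have [s sE] := sh_surj (j ∘ r).
have rE : r = i ∘ sh s by rewrite -sE compA ij comp1m.
exists W', s, i; split=> //.
have [Z [g [h d]]] := dist_cone s; exists Z, g, h; split=> //.
apply: (ts_desusp HP).
suff d' : dist r (sh g ∘ j) (- sh h) by apply: cone_inP d' Pr.
apply: (dist_iso (a := idm _) (b := i) (c := idm _) _ _ _ _ _ _ (dist_susp d));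
  rewrite ?fmap1 ?comp1m ?compm1 //; try exact: iso_idm.
by rewrite -compA ji compm1.
Qed.

(** Composites are treated by the octahedral axiom.  For an Ore square on s and
    f, the connecting map of s is pushed along f, which keeps the cone.  If f
    kills s it factors through the cone Z of s as u, and the cone map of u
    is a denominator, with cone Z[1], that kills f. *)
Lemma cone_in_left_system : left_system (cone_in P).
Proof.
split.
- move=> X; have [T T0] := zero_object.
  by exists T, 0, 0; split; [apply: dist_idm|apply: (ts_zero HP)].
- move=> X Y Z g f [V [v [v' [dg PV]]]] [U [u [u' [df PU]]]].
  have [W [w [w' d]]] := dist_cone (g ∘ f).
  have [a [b [dab _ _]]] := dist_oct_ df dg d.
  by exists W, w, w'; split=> //; apply: (ts_ext HP dab).
- move=> X Y X' f s [Z [g [h [d PZ]]]].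
  have [Y' [s' [g' d']]] := dist_cocone (sh f ∘ h).
  have [|f' [e _]] := dist_fill_mid (a := f) (c := idm Z) d d'.
    by rewrite compm1.
  by exists Y', f', s'; split=> //; exists Z, g', (sh f ∘ h).
- move=> X X' Y s f [Z [g [h [d PZ]]]] fs0.
  have [u fE] := (dist_weak_coker d).2 _ _ fs0.
  have [Y' [s' [h' d']]] := dist_cone u.
  exists Y', s'; split; last by rewrite fE compA (dist_comp0 d') comp0m.
  exists Z[1], h', (- sh u); split; last exact: (ts_susp HP).
  by move/dist_rot: d'.
Qed.

End Triangles.

(** * The triangulated structure of the quotient *)

Section Quotient.
Variables (k : fieldType) (C : tricat k) (P : C -> Prop).
Hypothesis HP : tri_subcat P.
Variables (mB : C -> C -> lmodType k) (m : kcat_mixin mB).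
Local Notation B := (KCat m).
Variable Q : @functor_mixin k C B (fun X : C => X).
Local Notation S := (cone_in P).
Local Notation hom X Y := (@mor k B X Y).
Local Notation sh := (fmap (susp C)).
Implicit Types X Y Z W : C.

Definition quo X Y (f : @mor k C X Y) : hom X Y := fmap_ Q f.

Hypothesis quo_lin : forall X Y (a : k) (f g : @mor k C X Y),
  quo (a *: f + g) = a *: quo f + quo g.
Hypothesis quo_iso : forall X Y (s : @mor k C X Y), S s -> is_iso (quo s).
Hypothesis quo_decomp : forall X Y (a : hom X Y),
  exists (Y' : C) (f : @mor k C X Y') (s : @mor k C Y Y'),
    S s /\ quo s ∘ a = quo f.
Hypothesis quo_eq0 : forall X Y (f : @mor k C X Y),
  quo f = 0 -> exists (Y' : C) (s : @mor k C Y Y'), S s /\ s ∘ f = 0.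

Lemma quo1 X : quo (idm X) = @idm k B X.
Proof. exact: fmap1_ Q X. Qed.

Lemma quoM X Y Z (g : @mor k C Y Z) (f : @mor k C X Y) :
  quo (g ∘ f) = quo g ∘ quo f.
Proof. exact: fmap_comp_ Q _ _ _ g f. Qed.

Definition quo0 X Y : quo (0 : @mor k C X Y) = 0 := linmap0 (@quo_lin X Y).
Definition quoN X Y (f : @mor k C X Y) : quo (- f) = - quo f :=
  linmapN (@quo_lin X Y) f.
Definition quoB X Y (f g : @mor k C X Y) : quo (f - g) = quo f - quo g :=
  linmapB (@quo_lin X Y) f g.

Lemma iso_quo X Y (f : @mor k C X Y) : is_iso f -> is_iso (quo f).
Proof. by move=> [g [gf fg]]; exists (quo g); rewrite -!quoM gf fg !quo1. Qed.

Lemma quo_eq X Y (f g : @mor k C X Y) : quo f = quo g ->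
  exists (Y' : C) (s : @mor k C Y Y'), S s /\ s ∘ f = s ∘ g.
Proof.
move=> fg; have [|Y' [s [Ss s0]]] := quo_eq0 (f := f - g).
  by rewrite quoB fg subrr.
by exists Y', s; split=> //; apply/subr0_eq; rewrite -compmB.
Qed.

Let Sls := cone_in_left_system HP.

(** ** The suspension of the quotient *)

Definition qsh X Y (f : @mor k C X Y) : hom X[1] Y[1] := quo (sh f).

Lemma qshM X Y Z (g : @mor k C Y Z) (f : @mor k C X Y) :
  qsh (g ∘ f) = qsh g ∘ qsh f.
Proof. by rewrite /qsh fmapM quoM. Qed.

Lemma qsh_iso X Y (s : @mor k C X Y) : S s -> is_iso (qsh s).
Proof. by move=> Ss; apply/quo_iso/cone_in_susp. Qed.

(** Numerators and denominators may be suspended separately: two fractions for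
    the same morphism have a common expansion, and so have their suspensions. *)
Lemma quo_susp_exists X Y (a : hom X Y) : exists b : hom X[1] Y[1],
  forall Y' (f : @mor k C X Y') (s : @mor k C Y Y'),
    S s -> quo s ∘ a = quo f -> qsh s ∘ b = qsh f.
Proof.
have [Y0 [f0 [s0 [Ss0 af0]]]] := quo_decomp a.
have [i [is0 si0]] := qsh_iso Ss0.
exists (i ∘ qsh f0) => Y' f s Ss af.
have [W [r0 [r [Sr e]]]] := ls_ore Sls s Ss0.
have [|V [d [Sd ed]]] := @quo_eq _ _ (r0 ∘ f0) (r ∘ f).
  by rewrite !quoM -af0 -af !compA -!quoM e.
apply: (iso_lcancel (qsh_iso (ls_comp Sls Sd Sr))).
rewrite !compA -!qshM -!(compA d) e -ed !qshM -!compA.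
by rewrite (compA (qsh s0)) si0 comp1m.
Qed.

Definition quo_susp X Y (a : hom X Y) : hom X[1] Y[1] :=
  sval (cid (quo_susp_exists a)).

Lemma quo_suspP X Y (a : hom X Y) Y' (f : @mor k C X Y') (s : @mor k C Y Y') :
  S s -> quo s ∘ a = quo f -> qsh s ∘ quo_susp a = qsh f.
Proof. by rewrite /quo_susp; case: cid => b /= bP; apply: bP. Qed.

Lemma quo_susp_unique X Y (a : hom X Y) Y' (f : @mor k C X Y')
    (s : @mor k C Y Y') (b : hom X[1] Y[1]) :
  S s -> quo s ∘ a = quo f -> qsh s ∘ b = qsh f -> b = quo_susp a.
Proof.
move=> Ss af bf; apply: (iso_lcancel (qsh_iso Ss)).
by rewrite bf (quo_suspP Ss af).
Qed.

Lemma quo_susp_quo X Y (f : @mor k C X Y) : quo_susp (quo f) = qsh f.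
Proof.
apply/esym/(quo_susp_unique (f := f) (ls_id Sls Y)); first by rewrite quo1 comp1m.
by rewrite /qsh fmap1 quo1 comp1m.
Qed.

Lemma quo_susp1 X : quo_susp (@idm k B X) = @idm k B X[1].
Proof. by rewrite -quo1 quo_susp_quo /qsh fmap1 quo1. Qed.

Lemma quo_suspM X Y Z (b : hom Y Z) (a : hom X Y) :
  quo_susp (b ∘ a) = quo_susp b ∘ quo_susp a.
Proof.
have [Y' [f [s [Ss af]]]] := quo_decomp a.
have [Z' [g [t [St bg]]]] := quo_decomp b.
have [W [g' [r [Sr e]]]] := ls_ore Sls g Ss.
apply/esym/(quo_susp_unique (f := g' ∘ f) (ls_comp Sls Sr St)).
  by rewrite quoM -compA (compA (quo t)) bg compA -quoM e !quoM -compA af.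
rewrite qshM -compA (compA (qsh t)) (quo_suspP St bg) compA -qshM e !qshM.
by rewrite -compA (quo_suspP Ss af).
Qed.

Definition quo_susp_functor : functor B B :=
  @Functor k B B (fun X : C => X[1])
    (@FunctorMixin k B B (fun X : C => X[1]) quo_susp quo_susp1 quo_suspM).
Local Notation SB := quo_susp_functor.

Lemma quo_susp_linear : klinear SB.
Proof.
move=> X Y l a b.
have [Y1 [f [s [Ss af]]]] := quo_decomp a.
have [Y2 [g [t [St bg]]]] := quo_decomp b.
have [W [r [r' [Sr e]]]] := ls_ore Sls t Ss.
have Srt : S (r' ∘ t) := ls_comp Sls Sr St.
apply/esym/(quo_susp_unique (f := l *: (r ∘ f) + r' ∘ g) Srt).
  by rewrite quo_lin comp_linr {1}e !quoM -!compA af bg.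
rewrite comp_linr {1}e !qshM -!compA (quo_suspP Ss af) (quo_suspP St bg).
by rewrite -!qshM /qsh susp_lin quo_lin.
Qed.

Definition quo_suspB X Y (a b : hom X Y) :
  quo_susp (a - b) = quo_susp a - quo_susp b := linmapB (@quo_susp_linear X Y) a b.

(** If the suspended numerator is killed by a denominator, the latter descends,
    up to isomorphism, to a denominator that kills the numerator. *)
Lemma quo_susp_faithful X Y (a : hom X Y) : quo_susp a = 0 -> a = 0.
Proof.
move=> a0; have [Y1 [f [s [Ss af]]]] := quo_decomp a.
have : qsh f = 0 by rewrite -(quo_suspP Ss af) a0 compm0.
move=> /quo_eq0 [W [r [Sr rf]]].
have [W' [r' [i [Sr' ii rE]]]] := cone_in_desusp HP Sr.
have {}rf : r' ∘ f = 0.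
  by apply: sh_inj; apply: (iso_lcancel ii); rewrite fmapM compA -rE rf sh0 compm0.
apply: (iso_lcancel (quo_iso (ls_comp Sls Sr' Ss))).
by rewrite quoM -compA af -quoM rf quo0 compm0.
Qed.

Lemma quo_susp_full X Y (b : hom X[1] Y[1]) : exists a, quo_susp a = b.
Proof.
have [W [f [s [Ss bf]]]] := quo_decomp b.
have [W' [s' [i [Ss' ii sE]]]] := cone_in_desusp HP Ss.
have [j [ji ij]] := ii.
have [f' fE] := sh_surj (j ∘ f).
have [v [vs sv]] := quo_iso Ss'.
exists (v ∘ quo f'); apply/esym/(quo_susp_unique (f := f') Ss').
  by rewrite compA sv comp1m.
apply: (iso_lcancel (iso_quo ii)).
by rewrite /qsh compA -!quoM -sE bf -fE compA ij comp1m.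
Qed.

Lemma quo_susp_equivalence : equivalence SB.
Proof.
split=> [X Y|Y]; last first.
  have [X [f fi]] := desuspension (Y : C); exists X, (quo f); exact: iso_quo.
have [g gK] := choice (@quo_susp_full X Y).
exists g => // a; apply/subr0_eq/quo_susp_faithful.
by rewrite quo_suspB gK subrr.
Qed.

(** ** Triangles of the quotient *)

(** Clearing denominators in a map that kills [quo f] gives a map of the original
    category that kills f, which factors through g there. *)
Lemma quo_weak_coker X Y Z (f : @mor k C X Y) (g : @mor k C Y Z) :
  weak_coker f g -> weak_coker (quo f) (quo g).
Proof.
move=> [gf0 fact]; split; first by rewrite -quoM gf0 quo0.
move=> W u uf; have [W' [u' [s [Ss us]]]] := quo_decomp u.
have [|V [r [Sr]]] := quo_eq0 (f := u' ∘ f).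
  by rewrite quoM -us -compA uf compm0.
rewrite compA => /fact [v vE].
have i := quo_iso (ls_comp Sls Sr Ss); have [j [ji ij]] := i.
exists (j ∘ quo v); apply: (iso_lcancel i).
by rewrite !compA ij comp1m -quoM -vE !quoM -compA us.
Qed.

Lemma quo_exact X Y Z (f : @mor k C X Y) (g : @mor k C Y Z)
    (h : @mor k C Z X[1]) :
  dist f g h -> @exact_tri k B SB X Y Z (quo f) (quo g) (quo h).
Proof.
move=> /dist_exact [fg gh hf]; split; [exact: quo_weak_coker|exact: quo_weak_coker|].
by rewrite /fmap /= quo_susp_quo; apply: quo_weak_coker.
Qed.

Definition quo_dist X Y Z (f : hom X Y) (g : hom Y Z) (h : hom Z X[1]) : Prop :=
  exists (X' Y' Z' : C) (f' : @mor k C X' Y') (g' : @mor k C Y' Z')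
    (h' : @mor k C Z' X'[1]) (a : hom X X') (b : hom Y Y') (c : hom Z Z'),
    dist f' g' h' /\ [/\ is_iso a, is_iso b & is_iso c] /\
    [/\ b ∘ f = quo f' ∘ a, c ∘ g = quo g' ∘ b & quo_susp a ∘ h = quo h' ∘ c].

Lemma quo_dist_quo X Y Z (f : @mor k C X Y) (g : @mor k C Y Z)
    (h : @mor k C Z X[1]) : dist f g h -> quo_dist (quo f) (quo g) (quo h).
Proof.
move=> d; exists X, Y, Z, f, g, h, (idm _), (idm _), (idm _); split=> //; split.
  by split; apply: iso_idm.
by rewrite quo_susp1 !comp1m !compm1.
Qed.

Lemma iso_quo_susp X Y (a : hom X Y) : is_iso a -> is_iso (quo_susp a).
Proof. exact: (iso_fmap SB). Qed.

Lemma quo_dist_exact X Y Z (f : hom X Y) (g : hom Y Z) (h : hom Z X[1]) :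
  quo_dist f g h -> @exact_tri k B SB X Y Z f g h.
Proof.
move=> [X' [Y' [Z' [f' [g' [h' [a [b [c [d [[ia ib ic] [e1 e2 e3]]]]]]]]]]]].
exact: (exact_tri_iso (F := SB) ia ib ic e1 e2 e3 (quo_exact d)).
Qed.

Lemma quo_dist_iso X Y Z X' Y' Z'
    (f : hom X Y) (g : hom Y Z) (h : hom Z X[1])
    (f' : hom X' Y') (g' : hom Y' Z') (h' : hom Z' X'[1])
    (a : hom X X') (b : hom Y Y') (c : hom Z Z') :
  is_iso a -> is_iso b -> is_iso c ->
  b ∘ f = f' ∘ a -> c ∘ g = g' ∘ b -> quo_susp a ∘ h = h' ∘ c ->
  quo_dist f g h -> quo_dist f' g' h'.
Proof.
move=> ia ib ic bf cg ah.
move=> [X1 [Y1 [Z1 [f1 [g1 [h1 [a1 [b1 [c1 [d [[ia1 ib1 ic1] [e1 e2 e3]]]]]]]]]]]].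
have [a' [a'a aa']] := ia; have [b' [b'b bb']] := ib; have [c' [c'c cc']] := ic.
exists X1, Y1, Z1, f1, g1, h1, (a1 ∘ a'), (b1 ∘ b'), (c1 ∘ c').
split=> //; split.
  by split; apply: iso_comp => //; [exists a|exists b|exists c].
have sa := quo_suspM a' a; rewrite a'a quo_susp1 in sa.
split.
- apply: (iso_rcancel ia); rewrite -!compA -bf a'a compm1 -e1.
  by rewrite (compA b') b'b comp1m.
- apply: (iso_rcancel ib); rewrite -!compA -cg b'b compm1 -e2.
  by rewrite (compA c') c'c comp1m.
- apply: (iso_rcancel ic); rewrite -!compA -ah c'c compm1 -e3 quo_suspM.
  by rewrite -compA (compA (quo_susp a')) -sa comp1m.
Qed.

Lemma quo_dist_idm X Z : is_zero (Z : B) ->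
  quo_dist (@idm k B X) (0 : hom X Z) (0 : hom Z X[1]).
Proof.
move=> Z0; have [T T0] := zero_object C.
have T0' : is_zero (T : B) by rewrite /is_zero -quo1 T0 quo0.
exists X, X, T, (idm X), 0, 0, (@idm k B X), (@idm k B X), 0; split; first exact: dist_idm.
split; first by split; [exact: iso_idm|exact: iso_idm|exact: zero_iso].
split; first by rewrite quo1.
  by rewrite quo0 !comp0m.
by rewrite quo0 comp0m compm0.
Qed.

Lemma quo_dist_cone X Y (f : hom X Y) :
  exists (Z : C) (g : hom Y Z) (h : hom Z X[1]), quo_dist f g h.
Proof.
have [Y' [f' [s [Ss sf]]]] := quo_decomp f.
have [Z [g [h d]]] := dist_cone f'.
exists Z, (quo g ∘ quo s), (quo h).
exists X, Y', Z, f', g, h, (idm _), (quo s), (idm _); split=> //; split.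
  by split; [exact: iso_idm|exact: quo_iso|exact: iso_idm].
by rewrite quo_susp1 !comp1m !compm1.
Qed.

(** For the backward rotation, the last object of the representing triangle is
    replaced by a suspension, and full faithfulness of the suspension provides
    the missing isomorphism. *)
Lemma quo_dist_rot X Y Z (f : hom X Y) (g : hom Y Z) (h : hom Z X[1]) :
  quo_dist f g h <-> quo_dist g h (- quo_susp f).
Proof.
split.
  move=> [X' [Y' [Z' [f' [g' [h' [a [b [c [d [[ia ib ic] [e1 e2 e3]]]]]]]]]]]].
  exists Y', Z', X'[1], g', h', (- sh f'), b, c, (quo_susp a).
  split; first exact: (dist_rot _ _ _).1 d.
  split; first by split=> //; apply: iso_quo_susp.
  split=> //; rewrite quoN compmN compNm -/(qsh f') -quo_susp_quo -!quo_suspM.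
  by rewrite e1.
move=> [Y' [Z' [W [g' [h' [w [b [c [e [d [[ib ic ie] [e1 e2 e3]]]]]]]]]]]].
have [X' [i ii]] := desuspension W; have [j [ji ij]] := ii.
have [f' fE] := sh_surj (- (w ∘ i)).
have d' : dist f' g' (j ∘ h').
  apply/dist_rot; rewrite -fE opprK.
  apply: (dist_iso (a := idm _) (b := idm _) (c := j) _ _ _ _ _ _ d);
    rewrite ?comp1m ?compm1 ?fmap1 ?comp1m //; try exact: iso_idm.
    by exists i.
  by rewrite -compA ij compm1.
have [a aE] := quo_susp_full (quo j ∘ e).
have ij' : quo i ∘ quo j = idm _ by rewrite -quoM ij quo1.
have iqj : is_iso (quo j) by apply: iso_quo; exists i.
have ia : is_iso a.
  have [a1 [a1a aa1]] : is_iso (quo_susp a) by rewrite aE; apply: iso_comp.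
  have [a2 a2E] := quo_susp_full a1; exists a2.
  have inj X1 X2 (u v : hom X1 X2) : quo_susp u = quo_susp v -> u = v.
    have [/(_ X1 X2) [i' iK _] _] := quo_susp_equivalence.
    by move=> /(congr1 i'); rewrite !iK.
  by split; apply: inj; rewrite quo_suspM a2E ?a1a ?aa1 quo_susp1.
exists X', Y', Z', f', g', (j ∘ h'), a, b, c; split=> //; split=> //; split.
- have [/(_ X Y') [i' iK _] _] := quo_susp_equivalence.
  suff : quo_susp (b ∘ f) = quo_susp (quo f' ∘ a).
    by move=> /(congr1 i'); rewrite !iK.
  rewrite !quo_suspM quo_susp_quo /qsh -fE quoN quoM aE compNm -compA.
  rewrite (compA (quo i)) ij' comp1m.
  by apply: oppr_inj; rewrite opprK -e3 compmN.
- by [].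
- by rewrite aE quoM -compA e2 compA.
Qed.

(** The square between two images of triangles is first rewritten as a roof of
    two commutative squares of the original category; completing the
    denominators gives a morphism that is invertible by the five lemma. *)
Lemma quo_fill X Y Z X' Y' Z'
    (f : @mor k C X Y) (g : @mor k C Y Z) (h : @mor k C Z X[1])
    (f' : @mor k C X' Y') (g' : @mor k C Y' Z') (h' : @mor k C Z' X'[1])
    (a : hom X X') (b : hom Y Y') :
  dist f g h -> dist f' g' h' -> b ∘ quo f = quo f' ∘ a ->
  exists c : hom Z Z', c ∘ quo g = quo g' ∘ b /\ quo_susp a ∘ quo h = quo h' ∘ c.
Proof.
move=> d d' e.
have [X1 [a' [s [Ss sa]]]] := quo_decomp a.
have [Y1 [f1 [t [St tf]]]] := ls_ore Sls f' Ss.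
have [Y2 [b' [r [Sr rb]]]] := quo_decomp (quo t ∘ b).
have [|Y3 [v [Sv ve]]] := @quo_eq _ _ (b' ∘ f) (r ∘ f1 ∘ a').
  by rewrite quoM -rb -!compA e (compA (quo t)) -quoM tf !quoM -(compA (quo f1)) sa compA.
pose f3 := v ∘ r ∘ f1; pose t3 := v ∘ r ∘ t.
have St3 : S t3 by do 2 ?apply: (ls_comp Sls) => //.
have e1 : v ∘ b' ∘ f = f3 ∘ a' by rewrite -compA ve /f3 !compA.
have e2 : t3 ∘ f' = f3 ∘ s by rewrite /f3 /t3 -!compA tf.
have tb : quo t3 ∘ b = quo (v ∘ b') by rewrite /t3 !quoM -!compA rb.
have [Z3 [g3 [h3 d3]]] := dist_cone f3.
have [c1 [cg1 ch1]] := dist_fill d d3 e1.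
have [c0 [cg0 ch0]] := dist_fill d' d3 e2.
have ic0 : is_iso (quo c0).
  apply: (five_lemma (F := SB) (quo_exact d') (quo_exact d3) (quo_iso Ss) (quo_iso St3)).
  - by rewrite -!quoM e2.
  - by rewrite -!quoM cg0.
  - by rewrite /fmap /= quo_susp_quo /qsh -!quoM ch0.
have [i [ic ci]] := ic0.
exists (i ∘ quo c1); split.
  apply: (iso_lcancel ic0).
  by rewrite !compA ci comp1m -!quoM cg1 cg0 (quoM g3 t3) -compA tb -quoM.
apply: (iso_lcancel (qsh_iso Ss)).
rewrite (compA (qsh s)) (quo_suspP Ss sa) /qsh -quoM ch1.
rewrite (compA (quo (sh s))) -quoM ch0 (quoM h3 c0) -compA.
by rewrite (compA (quo c0)) ci comp1m quoM.
Qed.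

Lemma quo_dist_fill X Y Z X' Y' Z'
    (f : hom X Y) (g : hom Y Z) (h : hom Z X[1])
    (f' : hom X' Y') (g' : hom Y' Z') (h' : hom Z' X'[1])
    (a : hom X X') (b : hom Y Y') :
  quo_dist f g h -> quo_dist f' g' h' -> b ∘ f = f' ∘ a ->
  exists c : hom Z Z', c ∘ g = g' ∘ b /\ quo_susp a ∘ h = h' ∘ c.
Proof.
move=> [X1 [Y1 [Z1 [f1 [g1 [h1 [a1 [b1 [c1 [d1 [[ia1 ib1 ic1] [p1 p2 p3]]]]]]]]]]]].
move=> [X2 [Y2 [Z2 [f2 [g2 [h2 [a2 [b2 [c2 [d2 [[ia2 ib2 ic2] [q1 q2 q3]]]]]]]]]]]].
move=> e; have [a1' [a1'a a1a']] := ia1; have [b1' [b1'b b1b']] := ib1.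
have [c2' [c2'c c2c']] := ic2.
have [|c [cg ch]] := @quo_fill _ _ _ _ _ _ _ _ _ _ _ _
    (a2 ∘ a ∘ a1') (b2 ∘ b ∘ b1') d1 d2.
  apply: (iso_rcancel ia1).
  rewrite -!compA a1'a compm1 -p1 (compA b1') b1'b comp1m e.
  by rewrite !compA q1.
exists (c2' ∘ c ∘ c1); split; apply: (iso_lcancel ic2) || idtac.
  by rewrite !compA c2c' comp1m -compA p2 compA cg -!compA b1'b compm1 compA -q2 compA.
apply: (iso_lcancel (iso_quo_susp ia2)).
rewrite !compA -!quo_suspM q3 -!compA (compA c2) c2c' comp1m.
rewrite (compA (quo h2)) -ch -compA -p3 compA -quo_suspM.
by rewrite -!compA a1'a compm1.
Qed.

(** Octahedra only need to be found up to isomorphism: both morphisms are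
    replaced by images of composable morphisms of the original category, and
    the octahedron over the latter is carried back by completed isomorphisms. *)
Lemma quo_dist_oct X Y Z X' Y' Z' (f : hom X Y) (g : hom Y Z)
    (u : hom Y Z') (u' : hom Z' X[1]) (v : hom Z X') (v' : hom X' Y[1])
    (w : hom Z Y') (w' : hom Y' X[1]) :
  quo_dist f u u' -> quo_dist g v v' -> quo_dist (g ∘ f) w w' ->
  exists (a : hom Z' Y') (b : hom Y' X'),
    [/\ quo_dist a b (quo_susp u ∘ v'),
        w ∘ g = a ∘ u /\ w' ∘ a = u'
      & b ∘ w = v /\ v' ∘ b = quo_susp f ∘ w'].
Proof.
move=> df dg dgf.
have [Y1 [f1 [s [Ss sf]]]] := quo_decomp f.
have [i [is1 si]] := quo_iso Ss.
have [Z1 [g1 [t [St tg]]]] := quo_decomp (g ∘ i).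
have {}tg : quo t ∘ g = quo g1 ∘ quo s.
  by rewrite -tg -!compA is1 compm1.
have tgf : quo t ∘ (g ∘ f) = quo (g1 ∘ f1) ∘ idm _.
  by rewrite compA tg -compA sf quoM compm1.
have sf1 : quo s ∘ f = quo f1 ∘ idm _ by rewrite compm1.
have [Z1' [U [U' dU]]] := dist_cone f1.
have [X1' [V [V' dV]]] := dist_cone g1.
have [Y1' [W [W' dW]]] := dist_cone (g1 ∘ f1).
have [A1 [B1 [dAB [WA W'A] [BW V'B]]]] := dist_oct_ dU dV dW.
have qU := quo_dist_quo dU; have qV := quo_dist_quo dV.
have qW := quo_dist_quo dW.
have [cu [cuE cu'E]] := quo_dist_fill df qU sf1.
have [cv [cvE cv'E]] := quo_dist_fill dg qV tg.
have [cw [cwE cw'E]] := quo_dist_fill dgf qW tgf.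
have iid := @iso_idm k B X.
have iu : is_iso cu.
  exact: (five_lemma (F := SB) (quo_dist_exact df) (quo_dist_exact qU) iid (quo_iso Ss)).
have iv : is_iso cv.
  by apply: (five_lemma (F := SB) (quo_dist_exact dg) (quo_dist_exact qV)) (quo_iso Ss)
    (quo_iso St) _ _ _.
have iw : is_iso cw.
  exact: (five_lemma (F := SB) (quo_dist_exact dgf) (quo_dist_exact qW) iid (quo_iso St)).
rewrite quo_susp1 comp1m in cu'E; rewrite quo_susp1 comp1m in cw'E.
have [ju [juc cju]] := iu; have [jv [jvc cjv]] := iv; have [jw [jwc cjw]] := iw.
exists (jw ∘ quo A1 ∘ cu), (jv ∘ quo B1 ∘ cw); split; last 2 first.
- split.
    apply: (iso_lcancel iw); rewrite !compA cjw comp1m cwE -(compA (quo W)) tg.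
    by rewrite -(compA (quo A1)) cuE !compA -!quoM WA.
  by rewrite cw'E cu'E -!compA (compA cw) cjw comp1m compA -quoM W'A.
- split.
    apply: (iso_lcancel iv); rewrite !compA cjv comp1m -(compA (quo B1)) cwE cvE.
    by rewrite compA -quoM BW.
  apply: (iso_lcancel (iso_quo_susp (quo_iso Ss))).
  rewrite (compA _ v') cv'E -!compA (compA cv) cjv comp1m (compA (quo V')).
  rewrite -quoM V'B (compA _ (quo_susp f)) -quo_suspM sf1 compm1 quo_susp_quo.
  by rewrite cw'E quoM !compA.
apply: (quo_dist_iso (a := ju) (b := jw) (c := jv) _ _ _ _ _ _ (quo_dist_quo dAB)).
- by exists cu.
- by exists cw.
- by exists cv.
- by rewrite -compA cju compm1.
- by rewrite -compA cjw compm1.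
have -> : u = ju ∘ quo U ∘ quo s by rewrite -compA -cuE compA juc comp1m.
rewrite quoM -/(qsh U) -quo_susp_quo !quo_suspM -!compA.
by rewrite (compA (quo_susp (quo s))) cv'E -compA cjv compm1.
Qed.

Lemma quo_sums n (Y : 'I_n -> B) : exists X : B, direct_sum Y X.
Proof.
have [X sX] := has_sums (Y : 'I_n -> C); exists X.
exact: (@direct_sum_fmap k C B (Functor Q) quo_lin).
Qed.

Definition quo_tri : tri_mixin B :=
  @TriMixin k B SB quo_susp_linear quo_susp_equivalence quo_sums quo_dist
    quo_dist_iso quo_dist_idm quo_dist_cone quo_dist_rot quo_dist_fill
    quo_dist_oct.

Lemma quo_functor_exact : @exact_functor k C (TriCat quo_tri) (Functor Q).
Proof.
split; first exact: quo_lin.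
exists (fun X => @idm k B X[1]); split.
- by move=> X; apply: iso_idm.
- move=> X Y f; rewrite comp1m compm1; exact/esym/quo_susp_quo.
- move=> X Y Z f g h d; rewrite comp1m; exact: quo_dist_quo.
Qed.

End Quotient.

(** * Cyclic order on the circle *)

Section Circle.
Variable R : realType.
Implicit Types a b c x z : R * R.

Lemma ccw_rot a b c : ccw a b c -> ccw b c a.
Proof. by rewrite /ccw => h; lra. Qed.

Lemma ccwaba a b : ~ ccw a b a.
Proof. by rewrite /ccw => h; lra. Qed.

Definition orient a b c : R :=
  (b.1 - a.1) * (c.2 - a.2) - (b.2 - a.2) * (c.1 - a.1).

(** Distance from x to the tangent at z, and abscissa along that tangent. *)
Definition depth z x : R := 1 - (z.1 * x.1 + z.2 * x.2).
Definition absc z x : R := z.1 * x.2 - z.2 * x.1.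

Lemma absc_sqr z x : circle z -> circle x ->
  absc z x ^+ 2 = depth z x * (2 - depth z x).
Proof.
rewrite /circle /absc /depth /= => cz cx.
have : (z.1 ^+ 2 + z.2 ^+ 2) * (x.1 ^+ 2 + x.2 ^+ 2) = 1 by rewrite cz cx mulr1.
by move=> e; lra.
Qed.

Lemma depth_ge0 z x : circle z -> circle x -> 0 <= depth z x.
Proof.
rewrite /circle /depth /= => cz cx.
by have := sqr_ge0 (z.1 - x.1); have := sqr_ge0 (z.2 - x.2); lra.
Qed.

Lemma orient_frame z x y : circle z ->
  orient z x y = absc z x * depth z y - depth z x * absc z y.
Proof.
rewrite /circle /orient /absc /depth /= => cz.
transitivity ((x.1 * y.2 - x.2 * y.1) * 1 - x.1 * z.2 - z.1 * y.2 + x.2 * z.1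
  + z.2 * y.1); first by ring.
by rewrite -{1}cz; ring.
Qed.

(** The stereographic images [- absc / depth] of m, b, n from a come in
    increasing order, and the Vandermonde product of these images is
    [orient m b n] up to a positive factor. *)
Lemma ccw_trans a m b n : circle a -> circle m -> circle b -> circle n ->
  ccw a m b -> ccw a b n -> ccw m b n.
Proof.
move=> ca cm cb cn.
change (0 < orient a m b -> 0 < orient a b n -> 0 < orient m b n).
have -> : orient m b n = orient a m b + orient a b n - orient a m n.
  by rewrite /orient; ring.
rewrite !orient_frame //.
move: (absc_sqr ca cm) (absc_sqr ca cb) (absc_sqr ca cn).
move: (depth_ge0 ca cm) (depth_ge0 ca cb) (depth_ge0 ca cn).
move: (depth a m) (depth a b) (depth a n) (absc a m) (absc a b) (absc a n).
clear => Am Ab An sm sb sn hm hb hn em eb en.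
set Dmb := sm * Ab - Am * sb; set Dbn := sb * An - Ab * sn.
set Dmn := sm * An - Am * sn => mb bn.
have pos (x u v w : R) : 0 <= x -> u ^+ 2 = x * (2 - x) ->
    0 < u * v - x * w -> 0 < x.
  rewrite le_eqVlt => /orP[/eqP <-|//]; rewrite mul0r => /eqP.
  by rewrite sqrf_eq0 => /eqP ->; rewrite !mul0r subrr ltxx.
have Am0 : 0 < Am by apply: (pos _ sm Ab sb hm em mb).
have Ab0 : 0 < Ab by apply: (pos _ sb An sn hb eb bn).
have An0 : 0 < An.
  by apply: (pos _ (- sn) Ab (- sb) hn); [rewrite sqrrN|rewrite /Dbn in bn; lra].
have mn : 0 < Dmn.
  have : 0 < Ab * Dmn.
    have -> : Ab * Dmn = An * Dmb + Am * Dbn by rewrite /Dmn /Dmb /Dbn; ring.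
    by rewrite addr_gt0 // mulr_gt0.
  by rewrite pmulr_rgt0.
have key : 2 * (Am * Ab * An) * (Dmb + Dbn - Dmn) = Dmb * Dbn * Dmn
    - Ab * An * Dbn * (sm ^+ 2 - Am * (2 - Am))
    + Am * An * Dmn * (sb ^+ 2 - Ab * (2 - Ab))
    - Ab * Am * Dmb * (sn ^+ 2 - An * (2 - An)).
  by rewrite /Dmn /Dmb /Dbn; ring.
move: key; rewrite em eb en !subrr !mulr0 subr0 addr0 subr0 => key.
have : 0 < 2 * (Am * Ab * An) * (Dmb + Dbn - Dmn).
  by rewrite key !mulr_gt0.
by rewrite pmulr_rgt0 // !mulr_gt0.
Qed.

Lemma circle_le1 x : circle x -> `|x.1| <= 1 /\ `|x.2| <= 1.
Proof.
rewrite /circle /= => cx; have := sqr_ge0 x.1; have := sqr_ge0 x.2.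
by split; rewrite -(@expr_le1 _ 2) // real_normK ?num_real //; lra.
Qed.

Lemma depth_gt0 z x : circle z -> circle x -> z <> x -> 0 < depth z x.
Proof.
move=> cz cx zx; rewrite lt_neqAle depth_ge0 // andbT; apply/eqP => d0.
have : (z.1 - x.1) ^+ 2 + (z.2 - x.2) ^+ 2 = 0.
  by rewrite /depth /circle /= in d0 cz cx; lra.
move/eqP; rewrite paddr_eq0 ?sqr_ge0 // !sqrf_eq0 !subr_eq0 => /andP[/eqP e1 /eqP e2].
by apply: zx; rewrite [z]surjective_pairing [x]surjective_pairing e1 e2.
Qed.

Lemma norm_mul_lt (u v e : R) : `|u| <= 1 -> `|v| < e -> `|u * v| < e.
Proof.
by move=> u1; apply: le_lt_trans; rewrite normrM ler_piMl.
Qed.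

(** The depth from z is quadratic in the abscissa, so it is negligible close
    to z: points on one side of z are in cyclic position with z and b. *)
Lemma ccw_near_side z b : circle z -> circle b -> z <> b ->
  exists2 e : R, 0 < e & forall x, circle x ->
    `|x.1 - z.1| < e -> `|x.2 - z.2| < e ->
    (ccw_side z x -> ccw z x b) /\ (ccw_side x z -> ccw b x z).
Proof.
move=> cz cb zb; have d0 := depth_gt0 cz cb zb.
(* The coordinates of z are at most 1, so e = depth z b / 8 gives
   |absc z x| <= 2 e < depth z b and depth z x <= 2 e <= 1. *)
exists (depth z b / 8); first by rewrite divr_gt0.
move=> x cx x1 x2; have [z1 z2] := circle_le1 cz.
have := norm_mul_lt z1 x1; have := norm_mul_lt z2 x2.
have := norm_mul_lt z1 x2; have := norm_mul_lt z2 x1.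
rewrite !ltr_norml => /andP[p1 p2] /andP[p3 p4] /andP[p5 p6] /andP[p7 p8].
have sb := absc_sqr cz cb; have sx := absc_sqr cz cx; have dx := depth_ge0 cz cx.
have db : absc z b ^+ 2 <= 1.
  by rewrite sb; have := sqr_ge0 (depth z b - 1); lra.
have d2 : depth z b <= 2.
  by have := sqr_ge0 (absc z b); rewrite sb pmulr_rge0 // subr_ge0.
have dx1 : depth z x <= 1.
  by rewrite /circle /depth /= in cz d2 *; rewrite /depth in p1 p2 p3 p4 p5 p6 p7 p8; lra.
have dxs : depth z x <= absc z x ^+ 2.
  by rewrite sx; rewrite ler_peMr //; lra.
have ax : `|absc z x| < depth z b.
  rewrite ltr_norml /absc; apply/andP; split; lra.
have db' : `|absc z b| <= 1 by rewrite -(@expr_le1 _ 2) // real_normK ?num_real.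
have bound : `|depth z x * absc z b| <= absc z x ^+ 2.
  rewrite normrM (ger0_norm dx); apply: le_trans dxs.
  by rewrite ler_piMr.
move: bound; rewrite ler_norml => /andP[bl bu].
split=> side.
  change (0 < orient z x b); rewrite orient_frame //.
  have {}side : 0 < absc z x by [].
  have := mulr_gt0 side (_ : 0 < depth z b - absc z x).
  by rewrite subr_gt0 (le_lt_trans (ler_norm _) ax) => /(_ isT); lra.
have {}side : absc z x < 0 by rewrite /ccw_side in side; rewrite /absc; lra.
apply: ccw_rot; change (0 < orient z b x); rewrite orient_frame //.
have side' : 0 < - absc z x by rewrite oppr_gt0.
have gap : 0 < depth z b + absc z x by move: ax; rewrite ltr_norml => /andP[]; lra.
by have := mulr_gt0 side' gap; lra.
Qed.

(** [orient b y x] is affine in y. *)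
Lemma ccw_near b x z : ccw b z x -> circle b -> circle x ->
  exists2 e : R, 0 < e & forall y,
    `|y.1 - z.1| < e -> `|y.2 - z.2| < e -> ccw b y x.
Proof.
move=> c cb cx.
(* Moving z by less than e changes the orientation by less than 4 e. *)
exists (orient b z x / 8); first by rewrite divr_gt0.
have [b1 b2] := circle_le1 cb; have [x1 x2] := circle_le1 cx.
move=> y y1 y2.
have := norm_mul_lt b1 y2; have := norm_mul_lt b2 y1.
have := norm_mul_lt x1 y2; have := norm_mul_lt x2 y1.
rewrite !ltr_norml => /andP[p1 p2] /andP[p3 p4] /andP[p5 p6] /andP[p7 p8].
have {}c : 0 < orient b z x by [].
by rewrite /ccw; rewrite /orient in c p1 p2 p3 p4 p5 p6 p7 p8; lra.
Qed.

End Circle.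

(** * Arcs of the marked disk *)

Section Arcs.
Variables (R : realType) (M : set (R * R)) (t : R * R -> int -> R).
Hypotheses (hM : marked_disk M) (ht : added_points M t).
Local Notation N := (marked' M t).
Implicit Types (p q : bpoint R) (z m : R * R).

Lemma cvg_coord (u : nat -> R * R) z : u @ \oo --> z ->
  forall e : R, 0 < e -> exists n, `|(u n).1 - z.1| < e /\ `|(u n).2 - z.2| < e.
Proof.
move=> uz e e0; have /uz : nbhs z (ball z e) by exact: nbhsx_ballx.
rewrite /nbhs /= => -[n _ /(_ n (leqnn n))] /= [].
by rewrite -!ball_normE /ball_ /= !(distrC z.1) !(distrC z.2) => ? ?; exists n.
Qed.

(** The circle is closed: if z had squared norm [1 + h] with h nonzero, points of
    M within min(1, |h| / 8) of z would have squared norm different from 1. *)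
Lemma acc_circle z : acc M z -> circle z.
Proof.
move=> az; have [[u [_ uM _ uz]] _] := acc_two_sided hM az.
have uc n : circle (u n) := marked_on_circle hM (uM n).
have {}uz := cvg_coord uz.
rewrite /circle /=; apply/eqP; rewrite -subr_eq0; apply/negPn/negP => h0.
set h := _ - 1 in h0; have a0 : 0 < `|h| by rewrite normr_gt0.
have e0 : 0 < Num.min 1 (`|h| / 8) by rewrite lt_min ltr01 divr_gt0.
have [n [d1 d2]] := uz _ e0; move: d1 d2.
rewrite !lt_min => /andP[d1 d1'] /andP[d2 d2'].
have [l1 l2] := circle_le1 (uc n).
have := norm_mul_lt l1 d1'; have := norm_mul_lt l2 d2'.
have := norm_mul_lt (ltW d1) d1'; have := norm_mul_lt (ltW d2) d2'.
have := uc n; rewrite /circle /= => cu.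
rewrite !ltr_norml => /andP[p1 p2] /andP[p3 p4] /andP[p5 p6] /andP[p7 p8].
suff : `|h| < `|h| by rewrite ltxx.
by rewrite {1}/h ltr_norml; apply/andP; split; lra.
Qed.

Lemma acc_notin z : acc M z -> ~ M z.
Proof.
move=> az mz; have := @disjoint_isolated_limit_point _ M.
by move=> /disj_setPS /(_ z); apply; split=> //; exact: (marked_discrete hM mz).
Qed.

Lemma marked'P p : N p ->
  (M p.1 /\ p.2 = 0) \/ (acc M p.1 /\ exists j, p.2 = t p.1 j).
Proof.
move=> [[m Mm <-]|[z [j [az ->]]]]; first by left.
by right; split=> //; exists j.
Qed.

Lemma marked'_circle p : N p -> circle p.1.
Proof. by move=> /marked'P [[/(marked_on_circle hM)]|[/acc_circle]]. Qed.

Lemma marked'_interval p : N p -> acc M p.1 -> added_interval M p.1 p.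
Proof.
move=> /marked'P [[Mp _]|[ap [j pj]]] az; first by have := acc_notin az.
by split=> //; split=> //; rewrite pj; exact: (added_in ht _ az).
Qed.

Lemma marked_near z : acc M z -> forall e : R, 0 < e ->
  exists m, [/\ M m, `|m.1 - z.1| < e & `|m.2 - z.2| < e].
Proof.
move=> az e e0; have [[u [_ uM _ uz]] _] := acc_two_sided hM az.
by have [n []] := cvg_coord uz e0; exists (u n).
Qed.

(** Going counter-clockwise from p to q one meets M: just after p or just
    before q when one of them lies in an added interval, and otherwise because
    any point of N strictly in between is in M or has points of M close to it. *)
Lemma marked_between p q : N p -> N q -> p.1 <> q.1 -> ~ cw_next N q p ->
  exists2 m, M m & ccw p.1 m q.1.
Proof.
move=> Np Nq pq pqN; have cp := marked'_circle Np; have cq := marked'_circle Nq.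
have [[Mp p0]|[ap _]] := marked'P Np; last first.
  have [[u [_ uM us uz]] _] := acc_two_sided hM ap.
  have [e e0 near] := ccw_near_side cp cq pq.
  have [n [n1 n2]] := cvg_coord uz e0; exists (u n) => //.
  by apply: (near _ _ n1 n2).1; [apply: (marked_on_circle hM)|apply: us].
have [[Mq q0]|[aq _]] := marked'P Nq; last first.
  have [_ [u [_ uM us uz]]] := acc_two_sided hM aq.
  have [e e0 near] := ccw_near_side cq cp (nesym pq).
  have [n [n1 n2]] := cvg_coord uz e0; exists (u n) => //.
  by apply: (near _ _ n1 n2).2; [apply: (marked_on_circle hM)|apply: us].
have [x [Nx pxq]] : exists x, N x /\ ccw' p x q.
  apply: contrapT => nx; apply: pqN; split=> // [pqE|x Nx pxq].
    by apply: pq; rewrite pqE.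
  by apply: nx; exists x.
have {pxq} pxq : ccw p.1 x.1 q.1.
  have [[Mx x0]|[ax _]] := marked'P Nx.
    case: pxq => [//|[[_ _]|[[_ _]|[[/esym//]|[/[swap] ]]]]].
    - by rewrite p0 x0 ltxx.
    - by rewrite x0 q0 ltxx.
    - by move=> xq px; case: pq; rewrite px.
  case: pxq => [//|[[px]|[[xq]|[[/esym//]|[/[swap] xq px]]]]].
  - by case: (acc_notin ax); rewrite -px.
  - by case: (acc_notin ax); rewrite xq.
  - by case: pq; rewrite px.
have [[Mx _]|[ax _]] := marked'P Nx; first by exists x.1.
have [e e0 near] := ccw_near pxq cp cq.
have [m [Mm m1 m2]] := marked_near ax e0.
by exists m => //; apply: near.
Qed.

Lemma arc_of_interval_or_apart (a : set (bpoint R)) : is_arc N a ->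
  (exists z, a `<=` added_interval M z) \/
  exists p q, [/\ a = [set p; q], N p, N q, p.1 <> q.1 & ~ neighbours N p q].
Proof.
move=> [p [q [Np Nq pq npq ->]]].
have [e|ne] := pselect (p.1 = q.1); last by right; exists p, q.
left; exists p.1.
have [[Mp p0]|[ap _]] := marked'P Np.
  have [[Mq q0]|[aq _]] := marked'P Nq.
    by case: pq; rewrite [p]surjective_pairing [q]surjective_pairing e p0 q0.
  by case: (acc_notin aq); rewrite -e.
move=> x [->|->]; first exact: marked'_interval.
by rewrite e; apply: marked'_interval; rewrite -?e.
Qed.

(** The ends p and q are strictly between the two points of M found on either
    side, which is why the latter are not neighbours. *)
Lemma crossing_marked_arc p q : N p -> N q -> p.1 <> q.1 -> ~ neighbours N p q ->
  exists m n, [/\ M m, M n, is_arc N [set (m, 0); (n, 0)]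
    & cross [set p; q] [set (m, 0); (n, 0)]].
Proof.
move=> Np Nq pq npq.
have [m Mm pmq] : exists2 m, M m & ccw p.1 m q.1.
  by apply: marked_between => // h; apply: npq; right.
have [n Mn qnp] : exists2 n, M n & ccw q.1 n p.1.
  by apply: marked_between => // [/esym//|h]; apply: npq; left.
exists m, n; split=> //; last first.
  by exists p, q, (m, 0), (n, 0); split=> //; left.
have cp := marked'_circle Np; have cq := marked'_circle Nq.
have cm := marked_on_circle hM Mm; have cn := marked_on_circle hM Mn.
have mqn : ccw m q.1 n.
  by apply: (ccw_trans cp cm cq cn pmq); do 2 apply: ccw_rot.
have npm : ccw n p.1 m.
  by apply: (ccw_trans cq cn cp cm qnp); do 2 apply: ccw_rot.
exists (m, 0), (n, 0); split=> //; try by left; exists m || exists n.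
- by left; exists n.
- by case=> mn; move: mqn; rewrite mn => /ccwaba.
- case=> -[_ _ _]; first by move=> /(_ p Np); apply; left.
  by move=> /(_ q Nq); apply; left.
Qed.

(** As r is outside the interval, the cyclic order p, r, q forces q before p in
    the interval; likewise q, s, p forces p before q. *)
Lemma interval_arc_not_cross z m n (a : set (bpoint R)) : M m -> M n ->
  a `<=` added_interval M z -> ~ cross a [set (m, 0); (n, 0)].
Proof.
move=> Mm Mn aI [p [q [r [s [aE bE prq qsp]]]]].
have [az [pz _]] : added_interval M z p by apply: aI; rewrite aE; left.
have [_ [qz _]] : added_interval M z q by apply: aI; rewrite aE; right.
have offz x : [set (m, 0); (n, 0)] x -> x.1 <> z.
  by move=> [->|->] /= e; case: (acc_notin az); rewrite -e.
have rz : r.1 <> z by apply: offz; rewrite bE; left.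
have sz : s.1 <> z by apply: offz; rewrite bE; right.
have side u v w : u.1 = z -> w.1 = z -> v.1 <> z -> ccw' u v w -> w.2 < u.2.
  move=> uz wz vz; rewrite /ccw' uz wz.
  case=> [/ccwaba//|[[/esym//]|[[//]|[[_ _ //]|[/esym//]]]]].
have := side _ _ _ pz qz rz prq; have := side _ _ _ qz pz sz qsp.
by move=> h1 h2; have := lt_trans h1 h2; rewrite ltxx.
Qed.

(** ** Neighbours inside an added interval *)

Lemma added_inj_lt z i j : acc M z -> (t z i < t z j) = (i < j).
Proof.
move=> az; have mono := fun i j => @added_increasing R M t ht z i j az.
case: (ltgtP i j) => [/mono//|/mono ji|->]; last by rewrite ltxx.
by apply/negbTE; rewrite -leNgt ltW.
Qed.

Lemma added_marked' z j : acc M z -> N (z, t z j).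
Proof. by move=> az; right; exists z, j. Qed.

Lemma added_in_interval z j : acc M z -> added_interval M z (z, t z j).
Proof. by move=> az; split=> //; split=> //; apply: (added_in ht). Qed.

Lemma interval_index z p : N p -> added_interval M z p -> exists j, p = (z, t z j).
Proof.
move=> Np [az [pz _]]; case: (marked'P Np) => [[Mp _]|[_ [j pj]]].
  by case: (acc_notin az); rewrite -pz.
by exists j; rewrite [p]surjective_pairing pj pz.
Qed.

Lemma cw_next_interval z i j : acc M z ->
  cw_next N (z, t z i) (z, t z j) <-> i = j + 1.
Proof.
move=> az; split=> [[_ _ ne nx]|->].
  apply: contrapT => ij; apply: (nx (z, t z (j + 1))); first exact: added_marked'.
  right; right; right; right; split=> //=; rewrite !added_inj_lt //.
  have : i != j by apply/eqP => e; apply: ne; rewrite e.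
  have [ij'|ji|->] := ltgtP i j; last by [].
    by move=> _; constructor 3; split=> //; lia.
  by move=> _; constructor 1; split; lia.
split=> //; try exact: added_marked'.
  by case=> e; have := added_inj_lt j (j + 1) az; rewrite e ltxx ltrDl ltr01.
move=> x Nx; rewrite /ccw' /=.
have lt1 : t z j < t z (j + 1) by rewrite added_inj_lt // ltrDl ltr01.
case=> [/ccwaba//|[[e ne]|[[e ne]|[[_ _ h]|[e _]]]]].
- by move=> _; apply: ne; rewrite -e.
- by [].
- by have := lt_trans h lt1; rewrite ltxx.
have [[Mx _]|[_ [l xl]]] := marked'P Nx; first by case: (acc_notin az); rewrite e.
rewrite xl -e !added_inj_lt //.
by case=> -[]; lia.
Qed.

End Arcs.

(** * The subcategory of objects supported on the added intervals *)

Section Indecomposables.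
Variables (k : fieldType) (A : tricat k).
Implicit Types X Y Z : A.
Local Notation sh := (fmap (susp A)).

(** The two idempotents of a decomposition add up to 1, so one is invertible; the
    other summand is then killed. *)
Lemma local_indecomposable X : local_end X -> indecomposable X.
Proof.
move=> [X0 loc]; split=> // Y1 Y2 [i [p [pi1 pi0 ip]]].
pose e j : mor X X := i j ∘ p j.
have kill j j' : j != j' -> is_iso (e j) -> is_zero (pair_fam Y1 Y2 j').
  move=> jj' ie; rewrite /is_zero -pi1.
  have -> : p j' = 0; last by rewrite comp0m.
  by apply: (iso_rcancel ie); rewrite /e compA pi0 // !comp0m.
have [ie|ne] := pselect (is_iso (e ord0)); first by right; apply: (kill ord0 ord_max isT ie).
have [ie|ne'] := pselect (is_iso (e ord_max)); first by left; apply: (kill ord_max ord0 isT ie).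
case: (loc _ _ ne ne'); have : idm X = e ord0 + e ord_max.
  rewrite -ip big_ord_recl big_ord1; congr (_ + e _); exact: val_inj.
by move=> <-; apply: iso_idm.
Qed.

Lemma direct_sum_desusp n (Z : 'I_n -> A) X : direct_sum Z X[1] ->
  exists W : 'I_n -> A, direct_sum W X /\ forall j, isomorphic (W j)[1] (Z j).
Proof.
move=> [i [p [pi1 pi0 ip]]].
have lift j : {Y : A & {u : mor Y[1] (Z j) & {i' : mor Y X & {p' : mor X Y |
    [/\ is_iso u, i j ∘ u = sh i' & p j = u ∘ sh p']}}}}.
  have [Y /cid [u iu]] := cid (desuspension (Z j)); have [v [vu uv]] := cid iu.
  have [i' iE] := cid (sh_surj (i j ∘ u)); have [p' pE] := cid (sh_surj (v ∘ p j)).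
  by exists Y, u, i', p'; split=> //; rewrite -pE compA uv comp1m.
have [W /all_tag [u /all_tag [i' /all_sig [p' E]]]] := all_tag lift.
have pu j l : u l ∘ sh (p' l ∘ i' j) = p l ∘ i j ∘ u j.
  by have [[_ eij _] [_ _ epl]] := (E j, E l); rewrite fmapM -eij compA -epl compA.
exists W; split; last by move=> j; exists (u j); have [] := E j.
exists i', p'; split.
- move=> j; apply: sh_inj; have [iu _ _] := E j; apply: (iso_lcancel iu).
  by rewrite pu pi1 comp1m fmap1 compm1.
- move=> j l jl; apply: sh_inj; have [iu _ _] := E l; apply: (iso_lcancel iu).
  by rewrite pu pi0 // comp0m sh0 compm0.
apply: sh_inj; rewrite (fmap_sum (@susp_lin k A)) fmap1 -ip.
by apply: eq_bigr => j _; have [_ e1 e2] := E j; rewrite fmapM -e1 e2 compA.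
Qed.

Lemma indecomposable_susp X : indecomposable X -> indecomposable X[1].
Proof.
move=> [X0 ind]; split=> [X10|Z1 Z2 /direct_sum_desusp [W [sW WZ]]].
  by apply: X0; apply: sh_inj; rewrite sh0 fmap1.
have WE : W = pair_fam (W ord0) (W ord_max).
  apply/funext => j; rewrite /pair_fam.
  case: ifP => [/eqP -> //|/negbT j0]; congr W; apply/val_inj => /=.
  by case: j j0 => [[|[|j]]].
rewrite WE in sW; case: (ind _ _ sW) => W0; [left|right].
  by have [f fi] := WZ ord0; apply: isomorphic_zero fi (zero_susp W0).
by have [f fi] := WZ ord_max; apply: isomorphic_zero fi (zero_susp W0).
Qed.

End Indecomposables.

Lemma has_dim0 (k : fieldType) (V : lmodType k) (v : V) : has_dim V 0 -> v = 0.
Proof.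
by move=> [phi [psi _ phiK]]; rewrite -(phiK v) (thinmx0 (psi v)) linear0.
Qed.

Lemma has_dim1 (k : fieldType) (V : lmodType k) :
  has_dim V 1 -> exists v : V, v <> 0.
Proof.
move=> [phi [psi psiK _]]; exists (phi (const_mx 1)) => e.
have /matrixP/(_ ord0 ord0) : const_mx 1 = 0 :> 'rV[k]_1.
  by rewrite -(psiK (const_mx 1)) e -(linear0 phi) psiK.
by rewrite !mxE => /eqP; rewrite oner_eq0.
Qed.

Section IntervalSubcategory.
Variables (k : fieldType) (R : realType) (M : set (R * R)) (t : R * R -> int -> R).
Variables (C : tricat k) (l : C -> set (bpoint R)).
Hypotheses (hM : marked_disk M) (ht : added_points M t).
Hypothesis hC : cluster_category (marked' M t) l.
Local Notation N := (marked' M t).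
Local Notation D := (subcat_D l (added_interval M)).
Local Notation sh := (fmap (susp C)).
Implicit Types X Y Z T : C.

Definition marked_arc_object T : Prop :=
  indecomposable T /\ exists m n, [/\ M m, M n & l T = [set (m, 0); (n, 0)]].

Lemma interval_hom0 X z T : indecomposable X -> l X `<=` added_interval M z ->
  marked_arc_object T -> forall f : mor X T[1], f = 0.
Proof.
move=> Xi lX [Ti [m [n [Mm Mn lT]]]] f; apply/has_dim0/(hom_noncross hC) => //.
by rewrite lT; apply: (interval_arc_not_cross hM Mm Mn lX).
Qed.

(** As arcs in an added interval are exactly those that no arc with both ends in
    M crosses, the subcategory is an orthogonal; this makes it closed under
    extensions. *)
Lemma subcat_D_orthogonal X :
  D X <-> forall T, marked_arc_object T -> forall f : mor X T[1], f = 0.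
Proof.
split=> [[n [Y [YP [i [p [_ _ ip]]]]]] T HT f|orth].
  rewrite -(compm1 f) -ip comp_sumr big1 // => j _; rewrite compA.
  by have [Yi [z lY]] := YP j; rewrite (interval_hom0 Yi lY HT (f ∘ i j)) comp0m.
have [n [Y [Yl [i [p [pi1 pi0 ip]]]]]] := cluster_krull_schmidt hC X.
exists n, Y; split; last by exists i, p.
move=> j; have Yi := local_indecomposable (Yl j); split=> //.
have [//|[a [b [lY Na Nb ab nab]]]] :=
  arc_of_interval_or_apart hM ht (arc_of_indec hC Yi).
have [m [m' [Mm Mm' arc cr]]] := crossing_marked_arc hM Na Nb ab nab.
have [T [Ti lT]] := arc_surj hC arc.
have [|f []] := @has_dim1 _ (mor (Y j) T[1]).
  by apply: (hom_cross hC) => //; rewrite lY lT.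
rewrite -(compm1 f) -pi1 compA (orth T _ (f ∘ p j)) ?comp0m //.
by split=> //; exists m, m'.
Qed.

(** Both suspension and desuspension only shift the indices of the two ends. *)
Lemma interval_indec_susp X z : indecomposable X -> l X `<=` added_interval M z ->
  indecomposable X[1] /\ l X[1] `<=` added_interval M z.
Proof.
move=> Xi lX; split; first exact: indecomposable_susp.
have [p [q [Np Nq _ _ lXE]]] := arc_of_indec hC Xi.
have pz : added_interval M z p by apply: lX; rewrite lXE; left.
have qz : added_interval M z q by apply: lX; rewrite lXE; right.
have az := pz.1.
have [i pE] := interval_index hM Np pz; have [j qE] := interval_index hM Nq qz.
have next a : cw_next N (z, t z a) (z, t z (a - 1)).
  by apply/(cw_next_interval hM ht) => //; rewrite subrK.
rewrite pE qE in lXE; rewrite (arc_susp hC Xi lXE (next i) (next j)).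
by move=> x [->|->]; apply: added_in_interval.
Qed.

Lemma interval_indec_desusp X z :
  indecomposable X -> l X `<=` added_interval M z ->
  exists Y, [/\ indecomposable Y, l Y `<=` added_interval M z
    & isomorphic Y[1] X].
Proof.
move=> Xi lX; have [p [q [Np Nq pq npq lXE]]] := arc_of_indec hC Xi.
have pz : added_interval M z p by apply: lX; rewrite lXE; left.
have qz : added_interval M z q by apply: lX; rewrite lXE; right.
have az := pz.1.
have [i pE] := interval_index hM Np pz; have [j qE] := interval_index hM Nq qz.
have next a : cw_next N (z, t z (a + 1)) (z, t z a).
  exact/(cw_next_interval hM ht).
have [|Y [Yi lY]] := arc_surj hC (a := [set (z, t z (i + 1)); (z, t z (j + 1))]).
  exists (z, t z (i + 1)), (z, t z (j + 1)).
  split=> //; try exact: added_marked'.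
    move=> [] /(congr1 (fun x => (x < t z (i + 1)) || (t z (i + 1) < x))).
    rewrite !(added_inj_lt ht) // ltxx !ltrD2r => /esym /norP[].
    rewrite -!leNgt => ij ji; apply: pq.
    by rewrite pE qE (le_anti (introT andP (conj ij ji))).
  by case=> /(cw_next_interval hM ht _ _ az) => [/addIr e|/addIr e];
     apply: npq; rewrite pE qE; [left|right]; apply/(cw_next_interval hM ht).
exists Y; split=> //.
  by rewrite lY => x [->|->]; apply: added_in_interval.
apply/(arc_inj hC) => //; first exact: indecomposable_susp.
by rewrite (arc_susp hC Yi lY (next i) (next j)) lXE pE qE.
Qed.

Lemma subcat_D_triangulated : tri_subcat D.
Proof.
split.
- by move=> X X0; apply/subcat_D_orthogonal => T _ f; apply: zero_mor_from.
- move=> X [n [Y [YP [i [p [_ _ ip]]]]]]; apply/subcat_D_orthogonal => T HT f.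
  rewrite -(compm1 f) -fmap1 -ip (fmap_sum (@susp_lin k C)) comp_sumr big1 // => j _.
  have [Yi [z lY]] := YP j; have [Yi' lY'] := interval_indec_susp Yi lY.
  by rewrite fmapM compA (interval_hom0 Yi' lY' HT (f ∘ sh (i j))) comp0m.
- move=> X [n [Y [YP [i [p [_ _ ip]]]]]]; apply/subcat_D_orthogonal => T HT f.
  apply: sh_inj; rewrite sh0 -(compm1 (sh f)) -ip comp_sumr big1 // => j _.
  have [Yi [z lY]] := YP j.
  have [W [Wi lW [u iu]]] := interval_indec_desusp Yi lY.
  suff e : sh f ∘ i j = 0 by rewrite compA e comp0m.
  apply: (iso_rcancel iu); have [g ->] := sh_surj (sh f ∘ i j ∘ u).
  by rewrite (interval_hom0 Wi lW HT g) sh0 comp0m.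
- move=> X Y Z f g h d /subcat_D_orthogonal DX /subcat_D_orthogonal DZ.
  apply/subcat_D_orthogonal => T HT u.
  have [v ->] := (dist_weak_coker d).2 _ u (DX T HT _).
  by rewrite (DZ T HT v) comp0m.
Qed.

End IntervalSubcategory.

Theorem proposition3p4 (k : closedFieldType) (R : realType)
    (M : set (R * R)) (t : R * R -> int -> R)
    (C : tricat k) (l : C -> set (bpoint R))
    (hM : marked_disk M) (ht : added_points M t)
    (hC : cluster_category (marked' M t) l) :
  let S := @Sigma k R C l (R * R)%type (added_interval M) in
  exists (V : forall X Y : C, GRing.Lmodule.axioms_ k (loc_hom S X Y))
         (m : kcat_mixin (fun X Y : C => GRing.Lmodule.Pack (V X Y))),
    fraction_category m /\
    exists (tri : tri_mixin (KCat m))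
           (pi : @functor_mixin k C (KCat m) (fun X : C => X)),
      (forall (X Y : C) (f : mor X Y),
         sval (fmap_ pi f) = frac_class S (Cospan f (idm Y))) /\
      @exact_functor k C (TriCat tri) (Functor pi).
Proof.
move=> S.
have HD := subcat_D_triangulated hM ht hC.
have HS : left_system S := cone_in_left_system HD.
exists (frac_module HS), (frac_mixin HS); split; first exact: frac_mixin_fraction.
have lin := @frac_of_linear k C S HS.
have inv := @frac_of_iso k C S HS.
have dec := @frac_of_decomp k C S HS.
have ker := @frac_of_eq0 k C S HS.
exists (@quo_tri k C _ HD _ _ (frac_functor HS) lin inv dec ker), (frac_functor HS).
split; first by move=> X Y f; exact: (frac_ofP HS f).2.
exact: quo_functor_exact.
Qed.
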